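(* Let $(X,\mathcal{B},\mu)$ be a probability space and $T_1,\dots,T_k$ measurable transformations of $(X,\mathcal{B})$ such that each $T_i$ has an invariant probability measure $\mu_i$ equivalent to $\mu$. The following are equivalent: (i) $T_1,\dots,T_k$ are jointly ergodic with respect to $(\mu;\mu_1,\dots,\mu_k)$, i.e. for all $f_1,\dots,f_k\in L^\infty$, $\lim_{N\to\infty}\frac1N\sum_{n=0}^{N-1}T_1^nf_1\cdots T_k^nf_k=\prod_i\int f_i\,d\mu_i$ in $L^2(\mu)$; (ii) for all bounded measurable $f_0,\dots,f_k$, $\lim_{N\to\infty}\frac1N\sum_{n=1}^N\int f_0\cdot T_1^nf_1\cdots T_k^nf_k\,d\mu=\int f_0\,d\mu\prod_{i=1}^k\int f_i\,d\mu_i$; (iii) (a) $T_1\times\cdots\times T_k$ is ergodic w.r.t. $\mu_1\times\cdots\times\mu_k$ and (b) for all bounded measurable $f_1,\dots,f_k$, $\lim_{N\to\infty}\frac1N\sum_{n=1}^N\int T_1^nf_1\cdots T_k^nf_k\,d\mu=\prod_i\int f_i\,d\mu_i$; (iv) (a) $T_1\times\cdots\times T_k$ is ergodic w.r.t. $\mu_1\times\cdots\times\mu_k$ and (b) there is $C>0$ such that for all $A_1,\dots,A_k\in\mathcal{B}$, $\limsup_{N\to\infty}\frac1N\sum_{n=1}^N\mu(T_1^{-n}A_1\cap\cdots\cap T_k^{-n}A_k)\le C\prod_i\mu_i(A_i)$.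
   Context: $T^nf:=f\circ T^n$. The probability space is a compact metric space with its Borel $\sigma$-algebra. *)

(* Defs.v *)
From HB Require Import structures.
From mathcomp Require Import all_boot all_order all_algebra.
From mathcomp Require Import all_classical all_reals all_analysis.
Set Implicit Arguments. Unset Strict Implicit. Unset Printing Implicit Defensive.
Import Order.TTheory GRing.Theory Num.Theory.
Import numFieldNormedType.Exports.
Local Open Scope classical_set_scope.
Local Open Scope ring_scope.

Definition borel (X : ptopologicalType) : measurableType _ :=
  g_sigma_algebraType (@open X).

Section defs.
Context (R : realType) (d : measure_display) (X : measurableType d).

Definition bounded_measurable (f : X -> R) :=
  measurable_fun [set: X] f /\ exists M : R, forall x, `|f x| <= M.

Definition is_invariant (T : X -> X) (mu : set X -> \bar R) :=
  forall A, measurable A -> mu (T @^-1` A) = mu A.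

Definition equiv_measures (mu nu : set X -> \bar R) :=
  mu `<< nu /\ nu `<< mu.

Definition ergodic_wrt (T : X -> X) (nu : set X -> \bar R) :=
  forall E, measurable E -> T @^-1` E = E -> nu E = 0%E \/ nu E = 1%E.

End defs.

Section prod.
Context (R : realType) (d : measure_display) (X : measurableType d) (k : nat).

Definition prod_map (T : 'I_k -> X -> X) (x : k.-tuple X) : k.-tuple X :=
  [tuple T i (tnth x i) | i < k].

(* nu (a measure on the product sigma-algebra of k.-tuple X) is the product
   measure mu_1 x ... x mu_k: it is determined by its values on rectangles *)
Definition is_product_measure (nu : set (k.-tuple X) -> \bar R)
    (mus : 'I_k -> set X -> \bar R) :=
  forall A : 'I_k -> set X, (forall i, measurable (A i)) ->
    nu [set x | forall i, A i (tnth x i)] = (\prod_(i < k) mus i (A i))%E.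

End prod.

(* Main.v *)
(**
(i) implies (ii) by Cauchy-Schwarz, (ii) implies (iii)(b) with [f0 = 1], and
(iii) implies (iv) with [C = 1]; the content is in the two other steps.

(ii) implies (iii)(a). Write S for the product map, nu for the product measure,
and let F be bounded, S-invariant, with vanishing integral in some coordinate j.
Write F_i(x, z) for F at z with the i-th coordinate replaced by x. The kernel
H_i(x, x') = int F_i(x, z) F_i(x', z) dnu(z) is invariant under T_i x T_i.
Apply (ii) to the slices f_i = F_i(., z_i), f0 = prod_i f_i, and integrate over
(z_1, ..., z_k): the integrals of prod_i H_i(T_i^n x, x) over mu tend to 0 in
mean. Since x |-> H_i(T_i^n x, x) is T_i-invariant, (ii) also gives
that this integral is prod_i a_i(n), where a_i(n) is the integral of
H_i(T_i^n x, x) over mu_i. Hence the averages of prod_i F_i(T_i^n x_i, z_i)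
tend to 0 in L^2, and by invariance F is orthogonal to every product of functions
int F_i(., z) h_i(z) dnu(z), then, replacing one factor at a time, to every
product function. Integrating the indicator function of an S-invariant set E one
coordinate after the other splits it into its mean and such functions F, so that
nu(E /\ A) = nu(E) nu(A) for all boxes A, thus also for A = E.

(iv) implies (i). For u = prod_i f_i(x_i) with mean c, the ergodic averages g_M
of u - c tend to 0 in L^2(nu). Up to a uniformly small error, g_M is constant on
the cells of a finite product partition, so (iv)(b) bounds the mean of g_M^2 along
the orbit of the diagonal by a multiple of its nu-integral. As the averages of
u - c and of g_M along an orbit are asymptotically equal, convexity gives (i).
*)

Require Import Defs.
From HB Require Import structures.
From mathcomp Require Import all_boot all_order all_algebra.
From mathcomp Require Import all_classical all_reals all_analysis.
From mathcomp Require Import measurable_realfun ring lra.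
Import Order.TTheory GRing.Theory Num.Theory.
Import numFieldNormedType.Exports.
Local Open Scope classical_set_scope.
Local Open Scope ring_scope.

(** * Integrals of bounded functions *)

Section bounded_measurable_algebra.
Context {R : realType} {d : measure_display} {X : measurableType d}.
Implicit Types f g : X -> R.

Lemma bmeas_cst (c : R) : bounded_measurable (fun _ : X => c).
Proof. by split; [exact: measurable_cst|exists `|c|]. Qed.

Lemma bmeasD {f g} : bounded_measurable f -> bounded_measurable g ->
  bounded_measurable (fun x => f x + g x).
Proof.
move=> [mf [M Mf]] [mg [N Ng]]; split; first exact: measurable_funD.
by exists (M + N) => x; rewrite (le_trans (ler_normD _ _))// lerD.
Qed.

Lemma bmeasM {f g} : bounded_measurable f -> bounded_measurable g ->
  bounded_measurable (fun x => f x * g x).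
Proof.
move=> [mf [M Mf]] [mg [N Ng]]; split; first exact: measurable_funM.
by exists (M * N) => x; rewrite normrM ler_pM.
Qed.

Lemma bmeasZ (c : R) {f} : bounded_measurable f ->
  bounded_measurable (fun x => c * f x).
Proof. by apply: bmeasM; exact: bmeas_cst. Qed.

Lemma bmeasB {f g} : bounded_measurable f -> bounded_measurable g ->
  bounded_measurable (fun x => f x - g x).
Proof.
move=> bf bg; have := bmeasD bf (bmeasZ (-1) bg).
by under [X in bounded_measurable X]eq_fun do rewrite mulN1r.
Qed.

Lemma bmeasX {f} n : bounded_measurable f ->
  bounded_measurable (fun x => f x ^+ n).
Proof.
move=> bf; elim: n => [|n ih].
  by under eq_fun do rewrite expr0; exact: bmeas_cst.
by under eq_fun do rewrite exprS; exact: bmeasM.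
Qed.

Lemma bmeas_sum {I} (s : seq I) (P : pred I) (f : I -> X -> R) :
  (forall i, bounded_measurable (f i)) ->
  bounded_measurable (fun x => \sum_(i <- s | P i) f i x).
Proof.
move=> bf; elim: s => [|i s ih].
  by under eq_fun do rewrite big_nil; exact: bmeas_cst.
under eq_fun do rewrite big_cons; case: (P i) => //; exact: bmeasD.
Qed.

Lemma bmeas_prod {I} (s : seq I) (P : pred I) (f : I -> X -> R) :
  (forall i, bounded_measurable (f i)) ->
  bounded_measurable (fun x => \prod_(i <- s | P i) f i x).
Proof.
move=> bf; elim: s => [|i s ih].
  by under eq_fun do rewrite big_nil; exact: bmeas_cst.
under eq_fun do rewrite big_cons; case: (P i) => //; exact: bmeasM.
Qed.

Lemma bmeas_indic (A : set X) : measurable A ->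
  bounded_measurable (\1_A : X -> R).
Proof.
move=> mA; split; first exact: measurable_indic.
by exists 1 => x; rewrite indicE ger0_norm// lern1 leq_b1.
Qed.

Lemma bmeas_comp {d'} {Y : measurableType d'} (phi : Y -> X) f :
  measurable_fun [set: Y] phi -> bounded_measurable f ->
  bounded_measurable (fun y => f (phi y)).
Proof.
move=> mphi [mf [M Mf]]; split; first exact: measurableT_comp.
by exists M.
Qed.

End bounded_measurable_algebra.

Section probability_integral.
Context {R : realType} {d : measure_display} {X : measurableType d}.
Variable P : probability X R.
Implicit Types f g : X -> R.

Lemma bmeas_integrable {f} : bounded_measurable f ->
  P.-integrable [set: X] (EFin \o f).
Proof.
move=> [mf [M Mf]]; apply: measurable_bounded_integrable => //.
  by apply: le_lt_trans (probability_le1 P measurableT) _; rewrite ltry.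
by exists M; split; [exact: num_real|move=> y /ltW My x _; exact: le_trans (Mf x) My].
Qed.

Lemma Rint_cst (c : R) : \int[P]_x c = c.
Proof.
have PT : fine (P [set: X]) = 1 by rewrite probability_setT.
by rewrite Rintegral_cst// -[RHS]mulr1 -PT.
Qed.

Lemma RintD {f g} : bounded_measurable f -> bounded_measurable g ->
  \int[P]_x (f x + g x) = \int[P]_x f x + \int[P]_x g x.
Proof. by move=> bf bg; rewrite RintegralD//; exact: bmeas_integrable. Qed.

Lemma RintB {f g} : bounded_measurable f -> bounded_measurable g ->
  \int[P]_x (f x - g x) = \int[P]_x f x - \int[P]_x g x.
Proof. by move=> bf bg; rewrite RintegralB//; exact: bmeas_integrable. Qed.

Lemma RintZ (c : R) {f} : bounded_measurable f ->
  \int[P]_x (c * f x) = c * \int[P]_x f x.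
Proof. by move=> bf; rewrite RintegralZl//; exact: bmeas_integrable. Qed.

Lemma Rint_sum {I} (s : seq I) (Q : pred I) (f : I -> X -> R) :
  (forall i, bounded_measurable (f i)) ->
  \int[P]_x (\sum_(i <- s | Q i) f i x) = \sum_(i <- s | Q i) \int[P]_x f i x.
Proof.
move=> bf; elim: s => [|i s ih].
  by under eq_Rintegral do rewrite big_nil; rewrite Rint_cst big_nil.
under eq_Rintegral do rewrite big_cons; rewrite big_cons; case: (Q i) => //.
by rewrite RintD ?ih//; exact: bmeas_sum.
Qed.

Lemma le_Rint {f g} : bounded_measurable f -> bounded_measurable g ->
  (forall x, f x <= g x) -> \int[P]_x f x <= \int[P]_x g x.
Proof. by move=> bf bg fg; apply: le_Rintegral => //; exact: bmeas_integrable. Qed.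

Lemma Rint_norm_le {f} (M : R) : measurable_fun [set: X] f ->
  (forall x, `|f x| <= M) -> `|\int[P]_x f x| <= M.
Proof.
move=> mf Mf; have bf : bounded_measurable f by split => //; exists M.
rewrite ler_norml; apply/andP; split.
  rewrite -[leLHS]Rint_cst; apply: le_Rint => //; first exact: bmeas_cst.
  by move=> x; have := Mf x; rewrite ler_norml => /andP[].
rewrite -[leRHS]Rint_cst; apply: le_Rint => //; first exact: bmeas_cst.
by move=> x; have := Mf x; rewrite ler_norml => /andP[].
Qed.

Lemma Rint_indic (A : set X) : measurable A -> \int[P]_x \1_A x = fine (P A).
Proof. by move=> mA; rewrite /Rintegral integral_indic// setIT. Qed.

(** The integral of [(t * f x + s * g x) ^+ 2] is a nonnegative quadratic form in [t] and [s], and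
    its discriminant gives the bound. *)
Lemma Rint_CauchySchwarz {f g} : bounded_measurable f -> bounded_measurable g ->
  (\int[P]_x (f x * g x)) ^+ 2 <= \int[P]_x (f x ^+ 2) * \int[P]_x (g x ^+ 2).
Proof.
move=> bf bg.
set a := \int[P]_x (f x ^+ 2); set b := \int[P]_x (f x * g x).
set c := \int[P]_x (g x ^+ 2).
have H (t s : R) : 0 <= t ^+ 2 * a + (2 * t * s) * b + s ^+ 2 * c.
  have -> : t ^+ 2 * a + (2 * t * s) * b + s ^+ 2 * c =
      \int[P]_x ((t * f x + s * g x) ^+ 2).
    rewrite -!RintZ; [|exact: bmeasX|exact: bmeasM|exact: bmeasX].
    rewrite -RintD; [|exact/bmeasZ/bmeasX|exact/bmeasZ/bmeasM].
    rewrite -RintD; [|by apply: bmeasD; apply: bmeasZ;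
      [exact: bmeasX|exact: bmeasM]|exact/bmeasZ/bmeasX].
    by apply: eq_Rintegral => x _; ring.
  by apply: Rintegral_ge0 => x _; exact: sqr_ge0.
have a0 : 0 <= a by apply: Rintegral_ge0 => x _; exact: sqr_ge0.
have c0 : 0 <= c by apply: Rintegral_ge0 => x _; exact: sqr_ge0.
have [a_eq0|a_neq0] := eqVneq a 0.
  suff -> : b = 0 by rewrite a_eq0 expr0n/= mul0r.
  apply/eqP/negPn/negP => b_neq0.
  (* With [a = 0] the form is affine in [t]; this [t] gives it the value -1. *)
  have := H (- (c + 1) / (2 * b)) 1; rewrite a_eq0.
  have -> : (- (c + 1) / (2 * b)) ^+ 2 * 0 + 2 * (- (c + 1) / (2 * b)) * 1 * b +
    1 ^+ 2 * c = -1 :> R by field.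
  lra.
have {a0}a_gt0 : 0 < a by rewrite lt_neqAle eq_sym a_neq0.
(* This [t] minimises the form at [s = 1]. *)
have := H (- b / a) 1.
have -> : (- b / a) ^+ 2 * a + 2 * (- b / a) * 1 * b + 1 ^+ 2 * c =
  (a * c - b ^+ 2) / a by field.
by rewrite pmulr_lge0 ?invr_gt0// subr_ge0.
Qed.

Lemma Rint_sqr_eq0_mul {f g} : bounded_measurable f -> bounded_measurable g ->
  \int[P]_x (g x ^+ 2) = 0 -> \int[P]_x (f x * g x) = 0.
Proof.
move=> bf bg g0; have := Rint_CauchySchwarz bf bg; rewrite g0 mulr0 => h.
by apply/eqP; rewrite -sqrf_eq0 eq_le h sqr_ge0.
Qed.

Lemma Rint_bounded_cvg (u : (X -> R)^nat) f (M : R) :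
  (forall n, measurable_fun [set: X] (u n)) -> (forall n x, `|u n x| <= M) ->
  measurable_fun [set: X] f ->
  {ae P, forall x, u ^~ x @ \oo --> f x} ->
  \int[P]_x u n x @[n --> \oo] --> \int[P]_x f x.
Proof.
move=> mu uM mf uf.
have [|||||iF _ H] := @dominated_convergence _ X R P [set: X] measurableT
  (fun n => EFin \o u n) (EFin \o f) (cst M%:E).
- by move=> n; exact/measurable_EFinP.
- exact/measurable_EFinP.
- by apply: filterS uf => x ux _; exact/cvg_EFin/ux/nearW.
- exact: (bmeas_integrable (bmeas_cst M)).
- by apply: aeW => x n _; rewrite lee_fin.
by have := fine_cvg (_ : _ --> (\int[P]_x f x)%:E); apply;
  rewrite /Rintegral fineK//; exact: integrable_fin_num.
Qed.

End probability_integral.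

Lemma Rint_image {R : realType} {d d'} {X : measurableType d}
    {Y : measurableType d'} (P : probability X R) (Q : probability Y R)
    (phi : X -> Y) (f : Y -> R) :
  measurable_fun [set: X] phi ->
  (forall A, measurable A -> Q A = P (phi @^-1` A)) ->
  bounded_measurable f ->
  \int[Q]_y f y = \int[P]_x f (phi x).
Proof.
move=> mphi QP bf; rewrite /Rintegral; congr fine.
have -> : (\int[Q]_x (f x)%:E = \int[pushforward P phi]_x (f x)%:E)%E.
  by apply: eq_measure_integral => A mA _; exact: QP.
rewrite integral_pushforward ?preimage_setT//.
  by apply/measurable_EFinP; case: bf.
apply: (bmeas_integrable P (f := fun x => f (phi x))).
exact: bmeas_comp.
Qed.

(** * Fubini's theorem for bounded functions *)

Section fubini_bounded.
Context {R : realType} {d d' : measure_display}.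
Context {X : measurableType d} {Y : measurableType d'}.
Variables (P : probability X R) (Q : probability Y R).
Variable f : X * Y -> R.
Hypothesis bf : bounded_measurable f.

Lemma bmeas_section1 x : bounded_measurable (fun y => f (x, y)).
Proof. by apply: bmeas_comp => //; exact: measurable_fun_pair. Qed.

Lemma bmeas_section2 y : bounded_measurable (fun x => f (x, y)).
Proof. by apply: bmeas_comp => //; exact: measurable_fun_pair. Qed.

Let EFin_int1 x : (\int[Q]_y f (x, y))%:E = (\int[Q]_y (f (x, y))%:E)%E.
Proof.
rewrite /Rintegral fineK//; apply: integrable_fin_num => //.
exact/bmeas_integrable/bmeas_section1.
Qed.

Let EFin_int2 y : (\int[P]_x f (x, y))%:E = (\int[P]_x (f (x, y))%:E)%E.
Proof.
rewrite /Rintegral fineK//; apply: integrable_fin_num => //.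
exact/bmeas_integrable/bmeas_section2.
Qed.

Lemma bmeas_Rint : bounded_measurable (fun x => \int[Q]_y f (x, y)).
Proof.
have [mf [M fM]] := bf; split; last first.
  by exists M => x; apply: Rint_norm_le => //; case: (bmeas_section1 x).
apply/measurable_EFinP.
rewrite [X in measurable_fun _ X](_ : _ = fun x => (\int[Q]_y (f (x, y))%:E)%E).
  (* Measurability of the inner integral concerns [Q] alone; a Dirac mass fills the place of the
     other measure, so the lemma does not depend on [P]. *)
  pose D : probability X R := dirac point.
  exact: (measurable_fubini_F (bmeas_integrable (D \x Q)%E bf)).
by apply/funext => x /=; rewrite EFin_int1.
Qed.

Lemma Rint_Fubini :
  \int[P]_x \int[Q]_y f (x, y) = \int[Q]_y \int[P]_x f (x, y).
Proof.
rewrite /Rintegral; congr fine.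
under eq_integral do rewrite EFin_int1.
under [RHS]eq_integral do rewrite EFin_int2.
exact: (Fubini (bmeas_integrable (P \x Q)%E bf)).
Qed.

Lemma Rint_prod_measure :
  \int[(P \x Q)%E]_z f z = \int[P]_x \int[Q]_y f (x, y).
Proof.
rewrite /Rintegral; congr fine.
under [RHS]eq_integral do rewrite EFin_int1.
by rewrite (integral12_prod_meas1 (bmeas_integrable (P \x Q)%E bf)).
Qed.

End fubini_bounded.

(** * Product measures on tuples *)

Lemma image_probability {R : realType} {d d'} {X : measurableType d}
    {Y : measurableType d'} (P : probability X R) (phi : X -> Y) :
  measurable_fun [set: X] phi ->
  exists Q : probability Y R, forall A, Q A = P (phi @^-1` A).
Proof.
move=> mphi.
pose fM := isMeasurableFun.Build _ _ _ _ phi mphi.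
pose f : {mfun X >-> Y} := HB.pack phi fM.
by exists (distribution P f).
Qed.

Section tuple_boxes.
Context {d : measure_display} {X : measurableType d} {k : nat}.

Definition box (A : 'I_k -> set X) : set (k.-tuple X) :=
  [set x | forall i, A i (tnth x i)].

Definition upd (x : k.-tuple X) (i : 'I_k) (t : X) : k.-tuple X :=
  [tuple if j == i then t else tnth x j | j < k].

Lemma tnth_upd x i t j : tnth (upd x i t) j = if j == i then t else tnth x j.
Proof. by rewrite tnth_mktuple. Qed.

Lemma measurable_upd i :
  measurable_fun [set: k.-tuple X * X] (fun p => upd p.1 i p.2).
Proof.
apply/measurable_fun_tnthP => j.
have [->|ji] := eqVneq j i.
  rewrite [X in measurable_fun _ X](_ : _ = snd)//.
  by apply/funext => -[x t] /=; rewrite tnth_upd eqxx.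
rewrite [X in measurable_fun _ X](_ : _ = (@tnth k X ^~ j) \o fst).
  by apply: measurableT_comp => //; exact: measurable_tnth.
by apply/funext => -[x t] /=; rewrite tnth_upd (negbTE ji).
Qed.

Lemma measurable_box A : (forall i, measurable (A i)) -> measurable (box A).
Proof.
move=> mA; rewrite (_ : box A = \bigcap_(i in [set: 'I_k])
    ((fun x => tnth x i) @^-1` A i)); last first.
  by apply/seteqP; split => x /= H i => [_|]; exact: H.
apply: fin_bigcap_measurable => // i _.
by rewrite -[X in measurable X]setTI; exact: measurable_tnth.
Qed.

Lemma indic_box {R : realType} (A : 'I_k -> set X) (x : k.-tuple X) :
  \1_(box A) x = \prod_(i < k) \1_(A i) (tnth x i) :> R.
Proof.
rewrite indicE; have [/set_mem xA|nA] := boolP (x \in box A).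
  rewrite big1// => i _.
  by rewrite indicE mem_set//; exact: xA.
have [i nAi] : exists i, ~ A i (tnth x i).
  by apply/existsNP => xA; move/negP: nA; apply; apply/mem_set.
by rewrite (bigD1 i)//= indicE memNset// mul0r.
Qed.

(** The sigma-algebra on tuples is generated by preimages under single coordinates, and each of
    these is a box whose other sides are full. *)
Lemma measurable_boxE :
  @measurable _ (k.-tuple X) =
  <<s [set B | exists2 A, (forall i, measurable (A i)) & B = box A] >>.
Proof.
apply/seteqP; split; last first.
  apply: smallest_sub; first exact: sigma_algebra_measurable.
  by move=> _ [A mA ->]; exact: measurable_box.
apply: smallest_sub; first exact: smallest_sigma_algebra.
rewrite -bigcup_seq => B [i /= _] [A mA] <-.
apply: sub_sigma_algebra; exists (fun j => if j == i then A else setT).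
  by move=> j; case: ifP.
rewrite setTI; apply/seteqP; split => x /=.
  by move=> Ax j; case: eqP => // ->.
by move=> /(_ i); rewrite eqxx.
Qed.

(** Boxes are stable under intersection and generate, so the uniqueness theorem for measures on a
    pi-system applies. *)
Lemma box_measure_unique {R : realType}
    (m1 m2 : {measure set (k.-tuple X) -> \bar R}) :
  (m1 [set: k.-tuple X] < +oo)%E ->
  (forall A, (forall i, measurable (A i)) -> m1 (box A) = m2 (box A)) ->
  forall B, measurable B -> m1 B = m2 B.
Proof.
move=> m1oo m12.
apply: (measure_unique [set B | exists2 A, (forall i, measurable (A i)) & B = box A]
  (fun _ => setT)).
- exact: measurable_boxE.
- move=> _ _ [A mA ->] [B mB ->]; exists (fun i => A i `&` B i).
    by move=> i; exact: measurableI.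
  apply/seteqP; split => x /=; first by move=> [xA xB] i; split.
  by move=> H; split => i; have [] := H i.
- by move=> _; exists (fun=> setT) => //; apply/seteqP; split.
- by apply/seteqP; split => // x _; exists 0%N.
- by move=> _ [A mA ->]; exact: m12.
- by [].
Qed.

End tuple_boxes.

Lemma product_measure_exists {R : realType} {d} {X : measurableType d} (k : nat)
    (m : 'I_k -> probability X R) :
  exists nu : probability (k.-tuple X) R, is_product_measure nu m.
Proof.
elim: k m => [m|k IH m].
  (* For [k = 0] the empty tuple is the only point and the empty product is 1. *)
  exists (dirac [tuple]) => A mA; rewrite big_ord0.
  rewrite (_ : [set x | _] = setT); first exact: probability_setT.
  by apply/seteqP; split => // x _ [].
have [nu nuP] := IH (fun i => m (lift ord0 i)).
have mcons : measurable_fun [set: X * k.-tuple X]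
    (fun p => [the k.+1.-tuple X of p.1 :: p.2]).
  by apply: measurable_cons.
have [Q QP] := image_probability (m ord0 \x nu)%E _ mcons.
exists Q => A mA; rewrite QP.
rewrite (_ : _ @^-1` _ = A ord0 `*` box (fun i => A (lift ord0 i))).
  rewrite big_ord_recl -nuP//.
  by apply: product_measure1E => //; exact: measurable_box.
apply/seteqP; split => -[x s] /=.
  move=> H; split; first exact: (H ord0).
  by move=> i /=; have := H (lift ord0 i); rewrite tnthS.
move=> [A0 AS] i; have [->//|] := eqVneq i ord0.
by case: (unliftP ord0 i) => [j ->|-> /eqP//] _; rewrite tnthS; exact: AS.
Qed.

Section product_probability.
Context {R : realType} {d : measure_display} {X : measurableType d} {k : nat}.
Context {m : 'I_k -> probability X R} {nu : probability (k.-tuple X) R}.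
Hypothesis nuP : is_product_measure nu m.

(** Recognises [nu] as the law of [phi] from box probabilities alone; this yields both the
    resampling of one coordinate and the invariance of [nu]. *)
Lemma product_measure_image {d'} {Y : measurableType d'} (P : probability Y R)
    (phi : Y -> k.-tuple X) : measurable_fun [set: Y] phi ->
  (forall A, (forall i, measurable (A i)) ->
    P (phi @^-1` box A) = \prod_(i < k) m i (A i))%E ->
  forall B, measurable B -> nu B = P (phi @^-1` B).
Proof.
move=> mphi Pphi; have [Q QP] := image_probability P _ mphi.
move=> B mB; rewrite -QP; apply: box_measure_unique => //.
  by apply: le_lt_trans (probability_le1 nu measurableT) _; rewrite ltry.
move=> A mA; apply: etrans (nuP _ mA) _; rewrite -Pphi//.
exact/esym/QP.
Qed.

(** Overwriting coordinate [i] by an independent draw from [m i] changes no box probability, hence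
    preserves the law [nu]. *)
Lemma Rint_upd (i : 'I_k) (f : k.-tuple X -> R) : bounded_measurable f ->
  \int[nu]_x f x = \int[nu]_z \int[m i]_t f (upd z i t).
Proof.
move=> bf.
rewrite -(Rint_prod_measure _ _ (fun p => f (upd p.1 i p.2))); last first.
  by apply: bmeas_comp bf; exact: measurable_upd.
apply: Rint_image => //; first exact: measurable_upd.
apply: product_measure_image; first exact: measurable_upd.
move=> A mA.
rewrite (_ : _ @^-1` _ = box (fun j => if j == i then setT else A j) `*` A i).
  apply: etrans (product_measure1E _ _ _ _) _ => //.
    by apply: measurable_box => j; case: ifP.
  have nuE : nu (box (fun j => if j == i then setT else A j)) =
      (\prod_(j < k) m j (if j == i then setT else A j))%E.
    by apply: nuP => j; case: ifP.
  apply: etrans (congr1 (mule^~ _) nuE) _.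
  rewrite (bigD1 i)//= eqxx probability_setT mul1e [RHS](bigD1 i)//= muleC.
  by congr (_ * _)%E; apply: eq_bigr => j /negbTE ->.
apply/seteqP; split => -[x t] /=.
  move=> H; split; last by have := H i; rewrite tnth_upd eqxx.
  by move=> j; have := H j; rewrite tnth_upd; case: eqP.
by move=> [H At] j; rewrite tnth_upd; case: eqP => [->//|/eqP/negbTE ji];
  have := H j; rewrite ji.
Qed.

Lemma bmeas_tnth (f : X -> R) (i : 'I_k) : bounded_measurable f ->
  bounded_measurable (fun x : k.-tuple X => f (tnth x i)).
Proof. by apply: bmeas_comp; exact: measurable_tnth. Qed.

Lemma Rint_prod_tuple (f : 'I_k -> X -> R) :
  (forall i, bounded_measurable (f i)) ->
  \int[nu]_x \prod_(i < k) f i (tnth x i) = \prod_(i < k) \int[m i]_t f i t.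
Proof.
move=> bf.
(* In [g n] the first [n] factors are replaced by their means; each induction step integrates out
   one more coordinate. *)
pose g (n : nat) (i : 'I_k) (t : X) : R :=
  if (i < n)%N then \int[m i]_t f i t else f i t.
have bg n i : bounded_measurable (g n i).
  by rewrite /g; case: (i < n)%N => //; exact: bmeas_cst.
suff H n : (n <= k)%N -> \int[nu]_x \prod_(i < k) f i (tnth x i) =
    \int[nu]_x \prod_(i < k) g n i (tnth x i).
  rewrite (H k)//; under eq_Rintegral => x _.
    under eq_bigr => i _ do rewrite /g ltn_ord.
    over.
  by rewrite Rint_cst.
elim: n => [_|n IH nk].
  by apply: eq_Rintegral => x _; apply: eq_bigr.
rewrite IH ?(ltnW nk)//; pose i := Ordinal nk.
rewrite (Rint_upd i); last by apply: bmeas_prod => j; exact: bmeas_tnth.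
apply: eq_Rintegral => z _.
under eq_Rintegral => t _.
  rewrite (bigD1 i)//= tnth_upd eqxx.
  under eq_bigr => j ji do rewrite tnth_upd (negbTE ji).
  rewrite mulrC; over.
rewrite RintZ// [RHS](bigD1 i)//= mulrC; congr (_ * _).
  by rewrite /g /= ltnn ltnSn.
apply: eq_bigr => j ji; rewrite /g ltnS [in RHS]leq_eqVlt.
by move: ji; rewrite -(inj_eq val_inj)/= => /negbTE ->.
Qed.

Lemma measurable_prod_map {T : 'I_k -> X -> X} :
  (forall i, measurable_fun [set: X] (T i)) ->
  measurable_fun [set: k.-tuple X] (prod_map T).
Proof.
move=> mT; apply/measurable_fun_tnthP => i.
rewrite [X in measurable_fun _ X](_ : _ = T i \o (@tnth k X ^~ i)).
  by apply: measurableT_comp => //; exact: measurable_tnth.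
by apply/funext => x /=; rewrite tnth_mktuple.
Qed.

Lemma product_measure_invariant {T : 'I_k -> X -> X} :
  (forall i, measurable_fun [set: X] (T i)) ->
  (forall i, is_invariant (T i) (m i)) -> is_invariant (prod_map T) nu.
Proof.
move=> mT iT A mA; apply/esym; apply: product_measure_image => //.
  exact: measurable_prod_map.
move=> {mA}A mA.
rewrite (_ : _ @^-1` _ = box (fun i => T i @^-1` A i)).
  apply: etrans (nuP _ _) _; last by apply: eq_bigr => i _; exact: iT.
  by move=> i; rewrite -[X in measurable X]setTI; exact: mT.
by apply/seteqP; split => x /= H i; have := H i; rewrite tnth_mktuple.
Qed.

End product_probability.

Lemma Rint_invariant {R : realType} {d} {X : measurableType d}
    {P : probability X R} {T : X -> X} (f : X -> R) :
  measurable_fun [set: X] T -> is_invariant T P -> bounded_measurable f ->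
  \int[P]_x f (T x) = \int[P]_x f x.
Proof.
by move=> mT iT bf; rewrite -(Rint_image P P _ _ mT)// => A mA; rewrite iT.
Qed.

(** * Iterates and Cesaro means *)

Lemma measurable_upd2 {d d'} {X : measurableType d} {Y : measurableType d'} {k}
    (i : 'I_k) (f : Y -> k.-tuple X) (g : Y -> X) :
  measurable_fun [set: Y] f -> measurable_fun [set: Y] g ->
  measurable_fun [set: Y] (fun y => upd (f y) i (g y)).
Proof.
move=> mf mg; apply: (measurableT_comp (measurable_upd i)
  (f := fun p => upd p.1 i p.2) (g := fun y => (f y, g y))).
exact: measurable_fun_pair.
Qed.

Lemma measurable_iter {d} {X : measurableType d} {T : X -> X} n :
  measurable_fun [set: X] T -> measurable_fun [set: X] (iter n T).
Proof.
move=> mT; elim: n => [|n IH]; first exact: measurable_id.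
exact: (measurableT_comp mT IH).
Qed.

Lemma is_invariant_iter {R : realType} {d} {X : measurableType d}
    {P : probability X R} {T : X -> X} n :
  measurable_fun [set: X] T -> is_invariant T P -> is_invariant (iter n T) P.
Proof.
move=> mT iT; elim: n => [|n IH] A mA //.
rewrite (_ : _ @^-1` _ = iter n T @^-1` (T @^-1` A)); last by apply/seteqP; split.
by rewrite IH ?iT//; rewrite -[X in measurable X]setTI; exact: mT.
Qed.

Lemma tnth_iter_prod_map {d} {X : measurableType d} {k} (T : 'I_k -> X -> X) n
    (x : k.-tuple X) i :
  tnth (iter n (prod_map T) x) i = iter n (T i) (tnth x i).
Proof. by elim: n => //= n IH; rewrite tnth_mktuple IH. Qed.

Section cesaro.
Context {R : realType}.
Implicit Types u c : R^nat.

(** The distance [|n - m|]: subtraction is truncated, so at least one summand is 0. *)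
Definition natdist (n m : nat) : nat := ((n - m) + (m - n))%N.

(** Enlarging the square by one adds a diagonal entry and two equal borders. On the right, [c]
    enters only through [c 0] and partial sums, which a Cesaro hypothesis controls. *)
Lemma sum_natdist c N :
  \sum_(0 <= n < N) \sum_(0 <= m < N) c (natdist n m) =
  \sum_(0 <= M < N) (c 0%N + 2 * \sum_(1 <= e < M.+1) c e).
Proof.
elim: N => [|N IH]; first by rewrite !big_geq.
rewrite big_nat_recr//= [RHS]big_nat_recr//= -IH.
under eq_bigr do rewrite big_nat_recr//=.
rewrite big_split/= big_nat_recr//= -!addrA; congr (_ + _).
have c0 : c (natdist N N) = c 0%N by rewrite /natdist subnn.
have revsum : \sum_(1 <= e < N.+1) c e = \sum_(0 <= n < N) c (natdist n N).
  rewrite big_add1/= big_nat_rev/= !big_mkord; apply: eq_bigr => i _.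
  rewrite add0n /natdist (eqP (_ : i - N == 0)%N) ?add0n; last first.
    by rewrite subn_eq0 ltnW.
  by rewrite -subSn ?subSS.
have sym : \sum_(0 <= m < N) c (natdist N m) = \sum_(0 <= n < N) c (natdist n N).
  by apply: eq_bigr => i _; rewrite /natdist addnC.
by rewrite c0 sym revsum; ring.
Qed.

Lemma cvgn0P u : u @ \oo --> (0 : R) <->
  forall e : R, 0 < e -> exists N0, forall N, (N0 <= N)%N -> `|u N| <= e.
Proof.
split=> [/cvgr0Pnorm_le H e e0|H].
  by have [N0 _ h] := H _ e0; exists N0 => N NN0; exact: h.
by apply/cvgr0Pnorm_le => e e0; have [N0 h] := H _ e0; exists N0.
Qed.

Lemma cesaro_natdist c : N%:R^-1 * (\sum_(1 <= n < N.+1) c n) @[N --> \oo] --> 0 ->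
  forall e : R, 0 < e -> exists2 N, (0 < N)%N &
  N%:R ^- 2 * (\sum_(0 <= n < N) \sum_(0 <= m < N) c (natdist n m)) <= e.
Proof.
move=> /cvgn0P H e e0.
have [N0 HN0] := H (e / 4) ltac:(lra).
(* [K] absorbs the finitely many partial sums below [N0], so that one affine bound holds for every
   [M]. *)
pose K : R := \sum_(0 <= M < N0) `|\sum_(1 <= n < M.+1) c n|.
have K0 : 0 <= K by exact: sumr_ge0.
have HM M : `|\sum_(1 <= n < M.+1) c n| <= K + e / 4 * M%:R.
  case: (ltnP M N0) => MN0.
    apply: ler_wpDr; first by rewrite mulr_ge0 ?ler0n//; lra.
    by rewrite /K big_mkord (bigD1 (Ordinal MN0))//= lerDl sumr_ge0.
  apply: ler_wpDl => //.
  have [->|M0] := posnP M; first by rewrite big_geq// normr0 mulr0.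
  have := HN0 _ MN0; rewrite normrM ger0_norm ?invr_ge0 ?ler0n//.
  by rewrite mulrC ler_pdivrMr ?ltr0n.
(* This makes the constant part at most [e / 2 * N]; the linear part accounts for the other half of
   [e]. *)
pose N := (Num.truncn (2 * (`|c 0%N| + 2 * K) / e)).+1.
exists N => //.
have N0' : 0 < N%:R :> R by rewrite ltr0n.
have NK : 2 * (`|c 0%N| + 2 * K) / e <= N%:R.
  by apply/ltW; exact: truncnS_gt.
rewrite mulrC ler_pdivrMr ?exprn_gt0// sum_natdist.
have h : \sum_(0 <= M < N) (c 0%N + 2 * \sum_(1 <= n < M.+1) c n) <=
    \sum_(0 <= M < N) (`|c 0%N| + 2 * K + e / 2 * N%:R).
  rewrite !big_nat; apply: ler_sum => M /andP[_ MN].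
  have := HM M; rewrite ler_norml => /andP[_ h].
  have := ler_norm (c 0%N).
  have : e / 4 * M%:R <= e / 4 * N%:R.
    by rewrite ler_wpM2l ?ler_nat ?(ltnW MN)//; lra.
  by move: h; lra.
apply: le_trans h _; rewrite big_const_nat iter_addr_0 subn0 -[leLHS]mulr_natr.
rewrite ler_pdivrMr// in NK.
rewrite [leRHS]mulrA ler_wpM2r ?ler0n//; lra.
Qed.

End cesaro.

(** * Ergodicity of the product map *)

Section invariant_function.
Context {R : realType} {d : measure_display} {X : measurableType d} {k : nat}.
Context {mu : probability X R} {T : 'I_k -> X -> X}.
Context {m : 'I_k -> probability X R} {nu : probability (k.-tuple X) R}.
Hypothesis mT : forall i, measurable_fun [set: X] (T i).
Hypothesis iT : forall i, is_invariant (T i) (m i).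
Hypothesis nuP : is_product_measure nu m.
Hypothesis weak_cvg : forall (f0 : X -> R) (f : 'I_k -> X -> R),
  bounded_measurable f0 -> (forall i, bounded_measurable (f i)) ->
  (fun N : nat => N%:R^-1 * \sum_(1 <= n < N.+1)
     \int[mu]_x (f0 x * \prod_(i < k) f i (iter n (T i) x)))
  @ \oo --> \int[mu]_x f0 x * \prod_(i < k) \int[m i]_x f i x.

Lemma average_cst (c : R) :
  N%:R^-1 * \sum_(1 <= n < N.+1) c @[N --> \oo] --> c.
Proof.
apply: (@cvg_trans _ ((fun=> c) @ \oo)); last exact: cvg_cst.
apply: near_eq_cvg; exists 1%N => // N /= N0.
by rewrite big_const_nat iter_addr_0 subSS subn0 -[c *+ _]mulr_natl mulKf// pnatr_eq0 -lt0n.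
Qed.

(** For invariant functions all terms averaged in [weak_cvg] with [f0 = 1] coincide, so their common
    value is the limit. *)
Lemma Rint_prod_invariant (h : 'I_k -> X -> R) :
  (forall i, bounded_measurable (h i)) -> (forall i x, h i (T i x) = h i x) ->
  \int[mu]_x \prod_(i < k) h i x = \prod_(i < k) \int[m i]_x h i x.
Proof.
move=> bh hT; have := weak_cvg _ _ (bmeas_cst 1) bh.
rewrite Rint_cst mul1r.
under eq_fun => N.
  under eq_bigr => n _.
    under eq_Rintegral => x _.
      rewrite mul1r; under eq_bigr => i _.
        rewrite (_ : h i (iter n (T i) x) = h i x); first over.
        by elim: n => //= n <-; rewrite hT.
      over.
    over.
  over.
by move=> /(cvg_unique (@Rhausdorff R) (average_cst _)).
Qed.

Variable F : k.-tuple X -> R.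
Hypothesis bF : bounded_measurable F.
Hypothesis FT : forall x, F (prod_map T x) = F x.

(** The kernel H_i of the opening overview. Coordinate [i] of [z] is overwritten, so in effect only
    the others are integrated. *)
Definition slice_kernel i (s t : X) : R :=
  \int[nu]_z (F (upd z i s) * F (upd z i t)).

Definition kernel_corr i n : R := \int[m i]_t slice_kernel i (iter n (T i) t) t.

Lemma prod_map_upd z i t : prod_map T (upd z i t) = upd (prod_map T z) i (T i t).
Proof.
by apply: eq_from_tnth => j; rewrite !tnth_mktuple; case: eqP => // ->.
Qed.

Lemma bmeas_slice_kernel {d'} {Y : measurableType d'} i (f g : Y -> X) :
  measurable_fun [set: Y] f -> measurable_fun [set: Y] g ->
  bounded_measurable (fun y => slice_kernel i (f y) (g y)).
Proof.
move=> mf mg; apply: (bmeas_Rint nu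
  (fun p : Y * k.-tuple X => F (upd p.2 i (f p.1)) * F (upd p.2 i (g p.1)))).
by apply: bmeasM; apply: bmeas_comp bF; apply: measurable_upd2 => //;
  apply: measurableT_comp.
Qed.

(** Since [nu] is invariant, [z] may be replaced by [prod_map T z]; the map then comes out of both
    updates and is absorbed by [F]. *)
Lemma slice_kernelT i s t :
  slice_kernel i (T i s) (T i t) = slice_kernel i s t.
Proof.
rewrite /slice_kernel -[LHS](Rint_invariant _ (measurable_prod_map mT)
  (product_measure_invariant nuP mT iT)).
  by apply: eq_Rintegral => z _; rewrite -!prod_map_upd !FT.
by apply: bmeasM; apply: bmeas_comp bF; apply: measurable_upd2.
Qed.

Lemma slice_kernel_iter i p n s t :
  slice_kernel i (iter (p + n) (T i) s) (iter p (T i) t) =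
  slice_kernel i (iter n (T i) s) t.
Proof. by elim: p => //= p IH; rewrite slice_kernelT. Qed.

(** The kernel is symmetric and invariant under a common shift of both arguments, so only the time
    difference matters. *)
Lemma kernel_corrE i n p :
  \int[m i]_t slice_kernel i (iter n (T i) t) (iter p (T i) t) =
  kernel_corr i (natdist n p).
Proof.
apply: eq_Rintegral => t _; rewrite /natdist.
have [np|pn] := leqP n p.
  have -> : slice_kernel i (iter n (T i) t) (iter p (T i) t) =
     slice_kernel i (iter p (T i) t) (iter n (T i) t).
    by apply: eq_Rintegral => z _; rewrite mulrC.
  by rewrite -[in LHS](subnKC np) slice_kernel_iter (eqP np).
have np := ltnW pn.
by rewrite -[in LHS](subnKC np) slice_kernel_iter (eqP np) addn0.
Qed.

Let Z : measurableType _ := k.-tuple X.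

Variable rho : probability (k.-tuple Z) R.
Hypothesis rhoP : is_product_measure rho (fun=> nu).

(** [rho] draws the tuples z_1, ..., z_k independently, one for each slice, so the integral splits
    into one kernel per coordinate. *)
Lemma Rint_prod_slices (s t : 'I_k -> X) :
  \int[rho]_z ((\prod_(i < k) F (upd (tnth z i) i (s i))) *
               \prod_(i < k) F (upd (tnth z i) i (t i))) =
  \prod_(i < k) slice_kernel i (s i) (t i).
Proof.
rewrite -(Rint_prod_tuple rhoP (fun i z => F (upd z i (s i)) * F (upd z i (t i)))).
  by apply: eq_Rintegral => z _; rewrite big_split.
by move=> i; apply: bmeasM; apply: bmeas_comp bF; apply: measurable_upd2.
Qed.

(** For fixed [z], [weak_cvg] applied to the slices has limit 0, because the slice in coordinate [j]
    has mean 0. Dominated convergence passes this to the integral over [rho], and Fubini identifies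
    each integrated term with the product of correlations. *)
Lemma cesaro_kernel_corr (j : 'I_k) :
  (forall z, \int[m j]_t F (upd z j t) = 0) ->
  N%:R^-1 * (\sum_(1 <= n < N.+1) \prod_(i < k) kernel_corr i n) @[N --> \oo] --> 0.
Proof.
move=> F0.
pose W (n : nat) (p : k.-tuple Z * X) : R :=
  (\prod_(i < k) F (upd (tnth p.1 i) i p.2)) *
  \prod_(i < k) F (upd (tnth p.1 i) i (iter n (T i) p.2)).
have bW n : bounded_measurable (W n).
  apply: bmeasM; apply: bmeas_prod => i; apply: bmeas_comp bF;
    apply: measurable_upd2.
  - exact: (measurableT_comp (measurable_tnth i)).
  - by [].
  - exact: (measurableT_comp (measurable_tnth i)).
  - by apply: measurableT_comp => //; exact: measurable_iter.
have WE n : \int[rho]_z \int[mu]_x W n (z, x) = \prod_(i < k) kernel_corr i n.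
  rewrite Rint_Fubini//; under eq_Rintegral => x _.
    rewrite (_ : (fun z => _) = (fun z =>
      (\prod_(i < k) F (upd (tnth z i) i ((fun=> x) i))) *
      \prod_(i < k) F (upd (tnth z i) i ((fun i => iter n (T i) x) i))))//.
    rewrite (Rint_prod_slices (fun=> x) (fun i => iter n (T i) x)).
    over.
  (* All factors are evaluated at the same point [x]; the integral still factorises because each is
     invariant under its own [T i]. *)
  rewrite (Rint_prod_invariant (fun i x => slice_kernel i x (iter n (T i) x))).
  - apply: eq_bigr => i _; rewrite /kernel_corr; apply: eq_Rintegral => t _.
    by apply: eq_Rintegral => z _; rewrite mulrC.
  - by move=> i; apply: bmeas_slice_kernel => //; exact: measurable_iter.
  - by move=> i x; rewrite -iterSr iterS slice_kernelT.
pose u N (z : k.-tuple Z) : R :=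
  N%:R^-1 * \sum_(1 <= n < N.+1) \int[mu]_x W n (z, x).
have bu N : bounded_measurable (u N).
  by apply: bmeasZ; apply: bmeas_sum => n; exact: bmeas_Rint.
have uE N : \int[rho]_z u N z =
    N%:R^-1 * (\sum_(1 <= n < N.+1) \prod_(i < k) kernel_corr i n).
  rewrite RintZ; last by apply: bmeas_sum => n; exact: bmeas_Rint.
  rewrite Rint_sum; last by move=> n; exact: bmeas_Rint.
  by congr (_ * _); apply: eq_bigr => n _; rewrite WE.
under eq_fun do rewrite -uE.
have [mF [M FM]] := bF.
have WM n z x : `|W n (z, x)| <= M ^+ k * M ^+ k.
  have -> : M ^+ k = \prod_(i < k) M by rewrite prodr_const card_ord.
  rewrite /W normrM !normr_prod; apply: ler_pM; rewrite ?prodr_ge0//;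
    by apply: ler_prod => i _; rewrite normr_ge0 FM.
suff : \int[rho]_z u N z @[N --> \oo] --> \int[rho]_z (cst (0 : R) z).
  by rewrite [X in _ --> X -> _]Rint_cst.
apply: (@Rint_bounded_cvg _ _ _ rho u (cst 0) (M ^+ k * M ^+ k)).
- by move=> N; case: (bu N).
- move=> N z; rewrite /u normrM ger0_norm ?invr_ge0 ?ler0n//.
  have [->|N0] := posnP N.
    rewrite invr0 mul0r; apply: le_trans (WM 0%N z point); exact: normr_ge0.
  rewrite mulrC ler_pdivrMr ?ltr0n//.
  apply: le_trans (ler_norm_sum _ _ _) _.
  apply: (@le_trans _ _ (\sum_(1 <= n < N.+1) (M ^+ k * M ^+ k))).
    apply: ler_sum => n _; apply: Rint_norm_le => //.
    by case: (bmeas_section1 _ (bW n) z).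
  by rewrite big_const_nat iter_addr_0 subSS subn0 -[leLHS]mulr_natr.
- exact: measurable_cst.
apply: aeW => z.
have := weak_cvg (fun x => \prod_(i < k) F (upd (tnth z i) i x))
  (fun i x => F (upd (tnth z i) i x)).
rewrite (bigD1 j)//= F0 mul0r mulr0; apply.
  by apply: bmeas_prod => i; apply: bmeas_comp bF; exact: measurable_upd2.
by move=> i; apply: bmeas_comp bF; exact: measurable_upd2.
Qed.


(** The integral operator with kernel [F (upd z i t)]; orthogonality to [F] is first proved for
    products of functions in its range. *)
Definition slice_transform i (h : Z -> R) (t : X) : R :=
  \int[nu]_z (F (upd z i t) * h z).

Lemma bmeas_slice_transform i h : bounded_measurable h ->
  bounded_measurable (slice_transform i h).
Proof.
move=> bh; apply: (bmeas_Rint nu (fun p : X * Z => F (upd p.2 i p.1) * h p.2)).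
apply: bmeasM; last by apply: bmeas_comp bh.
by apply: bmeas_comp bF; apply: measurable_upd2.
Qed.

(** By invariance of [F] and [nu], the integral [J] is the inner product of a fixed [G] with [V n]
    for every [n], hence with the mean of the [V n]. Cauchy-Schwarz bounds [J ^+ 2] by the squared
    norm of [G] times a double average of correlations, which depend on [natdist n p] only and
    become small on average. *)
Lemma Rint_mul_prod_slice_transform (j : 'I_k) (h : 'I_k -> Z -> R) :
  (forall z, \int[m j]_t F (upd z j t) = 0) ->
  (forall i, bounded_measurable (h i)) ->
  \int[nu]_x (F x * \prod_(i < k) slice_transform i (h i) (tnth x i)) = 0.
Proof.
move=> F0 bh; set J := (X in X = 0).
have mS := measurable_prod_map mT.
have iS := product_measure_invariant nuP mT iT.
pose V (n : nat) (p : k.-tuple X * k.-tuple Z) : R :=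
  \prod_(i < k) F (upd (tnth p.2 i) i (iter n (T i) (tnth p.1 i))).
have mV n (i : 'I_k) : measurable_fun [set: k.-tuple X * k.-tuple Z]
    (fun p => upd (tnth p.2 i) i (iter n (T i) (tnth p.1 i))).
  apply: measurable_upd2; first exact: (measurableT_comp (measurable_tnth i)).
  apply: measurableT_comp; first exact: measurable_iter.
  exact: (measurableT_comp (measurable_tnth i)).
have bV n : bounded_measurable (V n).
  by apply: bmeas_prod => i; apply: bmeas_comp bF.
pose G (p : k.-tuple X * k.-tuple Z) : R := F p.1 * \prod_(i < k) h i (tnth p.2 i).
have bG : bounded_measurable G.
  apply: bmeasM; first by apply: bmeas_comp bF.
  apply: bmeas_prod => i; apply: bmeas_comp (bh i).
  exact: (measurableT_comp (measurable_tnth i)).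
have JE n : J = \int[(nu \x rho)%E]_p (G p * V n p).
  rewrite Rint_prod_measure; last exact: bmeasM.
  rewrite /J -[LHS](Rint_invariant _ (measurable_iter n mS)
    (is_invariant_iter n mS iS)); last first.
    apply: bmeasM => //; apply: bmeas_prod => i; apply: bmeas_tnth.
    exact: bmeas_slice_transform.
  apply: eq_Rintegral => x _.
  rewrite (_ : F (iter n (prod_map T) x) = F x); last first.
    by elim: n => //= n IH; rewrite FT IH.
  rewrite /G /V /=.
  under [RHS]eq_Rintegral do rewrite -mulrA.
  rewrite RintZ; last first.
    apply: bmeasM; first by apply: bmeas_prod => i; exact: bmeas_tnth.
    exact: (bmeas_section1 _ (bV n) x).
  congr (_ * _).
  under eq_bigr do rewrite tnth_iter_prod_map /slice_transform.
  rewrite -(Rint_prod_tuple rhoP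
    (fun i z => F (upd z i (iter n (T i) (tnth x i))) * h i z))//.
    apply: eq_Rintegral => z _; rewrite -big_split/=; apply: eq_bigr => i _.
    by rewrite mulrC.
  by move=> i; apply: bmeasM => //; apply: bmeas_comp bF; apply: measurable_upd2.
have VV n p : \int[(nu \x rho)%E]_y (V n y * V p y) =
    \prod_(i < k) kernel_corr i (natdist n p).
  rewrite Rint_prod_measure; last exact: bmeasM.
  under eq_Rintegral => x _.
    rewrite /V /= (Rint_prod_slices (fun i => iter n (T i) (tnth x i))
      (fun i => iter p (T i) (tnth x i))).
    over.
  rewrite (Rint_prod_tuple nuP
    (fun i t => slice_kernel i (iter n (T i) t) (iter p (T i) t))).
    by apply: eq_bigr => i _; rewrite kernel_corrE.
  by move=> i; apply: bmeas_slice_kernel; exact: measurable_iter.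
set C := \int[(nu \x rho)%E]_p (G p ^+ 2).
have C0 : 0 <= C by apply: Rintegral_ge0 => p _; exact: sqr_ge0.
have JN N : (0 < N)%N -> J ^+ 2 <= C * (N%:R ^- 2 *
    \sum_(0 <= n < N) \sum_(0 <= p < N) \prod_(i < k) kernel_corr i (natdist n p)).
  move=> N0; pose B p : R := N%:R^-1 * \sum_(0 <= n < N) V n p.
  have bB : bounded_measurable B by apply: bmeasZ; exact: bmeas_sum.
  have -> : J = \int[(nu \x rho)%E]_p (G p * B p).
    under eq_Rintegral do rewrite /B mulrCA mulr_sumr.
    have bGV n : bounded_measurable (fun p => G p * V n p) by exact: bmeasM.
    rewrite RintZ; last exact: bmeas_sum.
    rewrite Rint_sum//; under eq_bigr do rewrite -JE.
    rewrite big_const_nat iter_addr_0 subn0 -[J *+ _]mulr_natl mulKf//.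
    by rewrite pnatr_eq0 -lt0n.
  suff -> : N%:R ^- 2 * \sum_(0 <= n < N) \sum_(0 <= p < N)
      \prod_(i < k) kernel_corr i (natdist n p) = \int[(nu \x rho)%E]_p (B p ^+ 2).
    exact: Rint_CauchySchwarz.
  under [RHS]eq_Rintegral => p _.
    rewrite /B exprMn [X in _ * X]expr2 big_distrlr/= exprVn; over.
  have bVV n q : bounded_measurable (fun p => V n p * V q p) by exact: bmeasM.
  rewrite RintZ; last by apply: bmeas_sum => n; exact: bmeas_sum.
  rewrite Rint_sum; last by move=> n; exact: bmeas_sum.
  congr (_ * _); apply: eq_bigr => n _; rewrite Rint_sum//.
  by apply: eq_bigr => p _; rewrite VV.
apply/eqP; rewrite -sqrf_eq0 eq_le sqr_ge0 andbT.
apply/ler_addgt0Pl => e e0; rewrite addr0.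
(* The denominator is [C + 1] because [C] may be 0. *)
have [N N0 HN] := cesaro_natdist (fun n => \prod_(i < k) kernel_corr i n)
  (cesaro_kernel_corr j F0) (e / (C + 1)) ltac:(by rewrite divr_gt0// ltr_wpDl).
apply: le_trans (JN N N0) _; apply: le_trans (ler_wpM2l C0 HN) _.
rewrite mulrA ler_pdivrMr ?ltr_wpDl//; nra.
Qed.

(** Induction on the number [n] of leading factors allowed to be arbitrary, the remaining ones being
    slice transforms; for [n = 0] this is the previous lemma. *)
Lemma Rint_mul_prod_eq0 (j : 'I_k) (g : 'I_k -> X -> R) :
  (forall z, \int[m j]_t F (upd z j t) = 0) ->
  (forall i, bounded_measurable (g i)) ->
  \int[nu]_x (F x * \prod_(i < k) g i (tnth x i)) = 0.
Proof.
move=> F0.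
suff H n : (n <= k)%N -> forall g : 'I_k -> X -> R,
    (forall i, bounded_measurable (g i)) ->
    (forall i : 'I_k, (n <= i)%N ->
      exists2 h, bounded_measurable h & g i = slice_transform i h) ->
    \int[nu]_x (F x * \prod_(i < k) g i (tnth x i)) = 0.
  by move=> bg; apply: (H k) => // i; rewrite leqNgt ltn_ord.
elim: n => [_ {}g bg gh|n IH nk {}g bg gh].
  pose h i := s2val (cid2 (gh i (leq0n i))).
  rewrite -(Rint_mul_prod_slice_transform j h F0); last first.
    by move=> i; rewrite /h; case: cid2.
  apply: eq_Rintegral => x _; congr (_ * _); apply: eq_bigr => i _.
  by rewrite /h; case: cid2 => /= hi _ <-.
pose i := Ordinal nk.
pose L (z : Z) := \prod_(l < k | l != i) g l (tnth z l).
have bL : bounded_measurable L by apply: bmeas_prod => l; exact: bmeas_tnth.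
pose Psi := slice_transform i L.
have bPsi : bounded_measurable Psi by exact: bmeas_slice_transform.
(* Integrating out all coordinates but [i] turns the integral into a pairing of the factor [q] with
   [Psi]. *)
have E (q : X -> R) : bounded_measurable q ->
    \int[nu]_x (F x * \prod_(l < k) (if l == i then q else g l) (tnth x l)) =
    \int[m i]_t (q t * Psi t).
  move=> bq; rewrite (Rint_upd nuP i); last first.
    apply: bmeasM => //; apply: bmeas_prod => l; apply: bmeas_tnth.
    by case: eqP.
  under eq_Rintegral => z _.
    under eq_Rintegral => t _.
      rewrite (bigD1 i)//= eqxx tnth_upd eqxx.
      under eq_bigr => l li do rewrite tnth_upd (negbTE li).
      over.
    over.
  rewrite (Rint_Fubini _ _ (fun p : Z * X => F (upd p.1 i p.2) * (q p.2 * L p.1))).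
    apply: eq_Rintegral => t _ /=; rewrite -RintZ.
      by apply: eq_Rintegral => z _; rewrite mulrCA.
    by apply: bmeasM => //; apply: bmeas_comp bF; exact: measurable_upd2.
  apply: bmeasM; first by apply: bmeas_comp bF; exact: measurable_upd2.
  apply: bmeasM; first exact: (bmeas_comp snd q measurable_snd bq).
  exact: (bmeas_comp fst L measurable_fst bL).
(* [Psi] is itself a slice transform, so with [q = Psi] the induction hypothesis applies: [Psi] has
   norm 0 and pairs to 0 with every [g i]. *)
have Psi0 : \int[m i]_t (Psi t ^+ 2) = 0.
  under eq_Rintegral do rewrite expr2.
  rewrite -E//.
  apply: (IH (ltnW nk) (fun l => if l == i then Psi else g l)).
    by move=> l /=; case: (l == i).
  move=> l nl /=; case: eqP => [->|/eqP li]; first by exists L.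
  apply: gh; rewrite ltn_neqAle nl andbT; apply: contra li => /eqP nl'.
  by apply/eqP/val_inj.
rewrite -(Rint_sqr_eq0_mul (m i) (bg i) bPsi Psi0) -E//.
apply: eq_Rintegral => x _; congr (_ * _); apply: eq_bigr => l _.
by case: eqP => [->|].
Qed.

End invariant_function.

(** * From orthogonality to ergodicity of the product map *)

Section weak_joint_ergodicity.
Context {R : realType} {d : measure_display} {X : measurableType d} {k : nat}.
Context {mu : probability X R} {T : 'I_k -> X -> X}.
Context {m : 'I_k -> probability X R} {nu : probability (k.-tuple X) R}.
Hypothesis mT : forall i, measurable_fun [set: X] (T i).
Hypothesis iT : forall i, is_invariant (T i) (m i).
Hypothesis nuP : is_product_measure nu m.

(** The conditional expectation given the other coordinates, kept as a function of the whole tuple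
    so that it can be iterated. *)
Definition avg_coord (i : 'I_k) (F : k.-tuple X -> R) (x : k.-tuple X) : R :=
  \int[m i]_t F (upd x i t).

Lemma bmeas_avg_coord i F : bounded_measurable F ->
  bounded_measurable (avg_coord i F).
Proof.
move=> bF; apply: (bmeas_Rint (m i) (fun p => F (upd p.1 i p.2))).
by apply: bmeas_comp bF; exact: measurable_upd.
Qed.

Lemma upd_upd (x : k.-tuple X) i s t : upd (upd x i s) i t = upd x i t.
Proof. by apply: eq_from_tnth => j; rewrite !tnth_upd; case: eqP. Qed.

Lemma avg_coord_prod_map i F : bounded_measurable F ->
  (forall x, F (prod_map T x) = F x) ->
  forall x, avg_coord i F (prod_map T x) = avg_coord i F x.
Proof.
move=> bF FT x; rewrite /avg_coord -[LHS](Rint_invariant _ (mT i) (iT i)).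
  by apply: eq_Rintegral => t _; rewrite -prod_map_upd FT.
by apply: bmeas_comp bF; apply: measurable_upd2.
Qed.

(** Integrated coordinates are overwritten and stop mattering; once [s] lists them all, the function
    is constant. *)
Lemma foldr_avg_coord_eq (s : seq 'I_k) F (x y : k.-tuple X) :
  (forall i, i \notin s -> tnth x i = tnth y i) ->
  foldr avg_coord F s x = foldr avg_coord F s y.
Proof.
elim: s x y => [|i s IH] x y xy /=.
  by congr F; apply: eq_from_tnth => i; exact: xy.
apply: eq_Rintegral => t _; apply: IH => j js; rewrite !tnth_upd.
by case: eqP => // /eqP ji; apply: xy; rewrite in_cons negb_or ji.
Qed.

Hypothesis weak_cvg : forall (f0 : X -> R) (f : 'I_k -> X -> R),
  bounded_measurable f0 -> (forall i, bounded_measurable (f i)) ->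
  (fun N : nat => N%:R^-1 * \sum_(1 <= n < N.+1)
     \int[mu]_x (f0 x * \prod_(i < k) f i (iter n (T i) x)))
  @ \oo --> \int[mu]_x f0 x * \prod_(i < k) \int[m i]_x f i x.

(** [F - avg_coord i F] is again invariant and has mean 0 in coordinate [i], so it is orthogonal to
    every product function. *)
Lemma Rint_mul_prod_avg_coord i F (g : 'I_k -> X -> R) : bounded_measurable F ->
  (forall x, F (prod_map T x) = F x) -> (forall i, bounded_measurable (g i)) ->
  \int[nu]_x (F x * \prod_(l < k) g l (tnth x l)) =
  \int[nu]_x (avg_coord i F x * \prod_(l < k) g l (tnth x l)).
Proof.
move=> bF FT bg; have bA := bmeas_avg_coord i F bF.
have bG : bounded_measurable (fun x : k.-tuple X => \prod_(l < k) g l (tnth x l)).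
  by apply: bmeas_prod => l; exact: bmeas_tnth.
have [rho rhoP] := product_measure_exists k (fun=> nu).
apply/eqP; rewrite -subr_eq0 -RintB; [|exact: bmeasM|exact: bmeasM].
under eq_Rintegral do rewrite -mulrBl.
apply/eqP; apply: (Rint_mul_prod_eq0 mT iT nuP weak_cvg
  (fun x => F x - avg_coord i F x) _ _ rho rhoP i) => //.
- exact: bmeasB.
- by move=> x; rewrite FT avg_coord_prod_map.
move=> z; have bFz : bounded_measurable (fun t => F (upd z i t)).
  by apply: bmeas_comp bF; apply: measurable_upd2.
rewrite RintB//; last by apply: bmeas_comp bA; apply: measurable_upd2.
rewrite -[X in _ - X](_ : avg_coord i F z = _) ?subrr//.
rewrite -[LHS](Rint_cst (m i)); apply: eq_Rintegral => t _.
by apply: eq_Rintegral => s _; rewrite upd_upd.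
Qed.

Lemma Rint_invariant_mul_prod F (g : 'I_k -> X -> R) : bounded_measurable F ->
  (forall x, F (prod_map T x) = F x) -> (forall i, bounded_measurable (g i)) ->
  \int[nu]_x (F x * \prod_(l < k) g l (tnth x l)) =
  \int[nu]_x F x * \int[nu]_x \prod_(l < k) g l (tnth x l).
Proof.
move=> bF FT bg; pose G := foldr avg_coord F (enum 'I_k).
have GE h : (forall i, bounded_measurable (h i)) ->
    \int[nu]_x (F x * \prod_(l < k) h l (tnth x l)) =
    \int[nu]_x (G x * \prod_(l < k) h l (tnth x l)).
  move=> bh; rewrite /G.
  suff [] : [/\ bounded_measurable (foldr avg_coord F (enum 'I_k)),
      forall x, foldr avg_coord F (enum 'I_k) (prod_map T x) =
        foldr avg_coord F (enum 'I_k) x &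
      \int[nu]_x (F x * \prod_(l < k) h l (tnth x l)) =
      \int[nu]_x (foldr avg_coord F (enum 'I_k) x * \prod_(l < k) h l (tnth x l))] by [].
  elim: (enum 'I_k) => [|i s [bs sT sE]] //=; split.
  - exact: bmeas_avg_coord.
  - exact: avg_coord_prod_map.
  - by rewrite sE; exact: Rint_mul_prod_avg_coord.
have [c Gc] : exists c, forall x, G x = c.
  exists (G point) => x; apply: foldr_avg_coord_eq => i.
  by rewrite mem_enum.
(* The constant is identified by testing against the product of constants 1. *)
have FE : \int[nu]_x F x = c.
  have := GE (fun _ _ => 1) (fun=> bmeas_cst 1).
  under eq_Rintegral do rewrite big1_eq mulr1.
  under [X in _ = X -> _]eq_Rintegral do rewrite big1_eq mulr1 Gc.
  by rewrite Rint_cst.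
rewrite GE// FE; under eq_Rintegral do rewrite Gc.
by rewrite RintZ//; apply: bmeas_prod => l; exact: bmeas_tnth.
Qed.

Lemma weak_cvg_prod_ergodic : ergodic_wrt (prod_map T) nu.
Proof.
move=> E mE ET.
have nuEfin : (fine (nu E))%:E = nu E by rewrite fineK// fin_num_measure.
have bE : bounded_measurable (\1_E : k.-tuple X -> R) by exact: bmeas_indic.
have E1T x : \1_E (prod_map T x) = \1_E x :> R.
  have ETx : E (prod_map T x) = E x by rewrite -[in RHS]ET.
  by rewrite !indicE; congr (nat_of_bool _)%:R; apply/idP/idP; rewrite !inE ETx.
have nuE0 : 0 <= fine (nu E) by exact: fine_ge0.
have EB B : measurable B -> nu (B `&` E) = (nu E * nu B)%E.
  move=> mB.
  (* Both sides are finite measures in [B], so comparing them on boxes suffices. *)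
  have /(_ _ _ B mB) H := @box_measure_unique d X k R (mrestr nu mE)
    (mscale (NngNum nuE0) nu).
  rewrite -[in RHS]nuEfin; apply: H => [|A mA].
    apply: le_lt_trans (_ : _ <= 1)%E _; last by rewrite ltry.
    by apply: probability_le1; exact: measurableI.
  have mbA := measurable_box A mA.
  have := Rint_invariant_mul_prod _ (fun i => \1_(A i)) bE E1T
    (fun i => bmeas_indic _ (mA i)).
  under eq_Rintegral do rewrite -indic_box.
  under [X in _ = _ * X -> _]eq_Rintegral do rewrite -indic_box.
  rewrite !Rint_indic// => H.
  change (nu (box A `&` E) = (fine (nu E))%:E * nu (box A))%E.
  rewrite -[nu (box A)]fineK ?fin_num_measure// -EFinM -H.
  rewrite -[LHS]fineK ?fin_num_measure//; last exact: measurableI.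
  rewrite -Rint_indic; last exact: measurableI.
  congr (_%:E); apply: eq_Rintegral => x _.
  by rewrite setIC indicI.
(* At [B = E] the identity says that [nu E] equals its own square. *)
have := EB E mE; rewrite setIid -nuEfin -EFinM => -[h].
have /eqP : fine (nu E) * (1 - fine (nu E)) = 0 by rewrite mulrBr mulr1 -h subrr.
by rewrite mulf_eq0 subr_eq0 => /orP[/eqP ->|/eqP <-]; [left|right].
Qed.

End weak_joint_ergodicity.

(** * The mean ergodic theorem *)

Section mean_ergodic.
Context {R : realType} {d : measure_display} {Y : measurableType d}.
Context {P : probability Y R} {S : Y -> Y}.
Hypothesis mS : measurable_fun [set: Y] S.
Hypothesis iS : is_invariant S P.

Definition birkhoff_sum (v : Y -> R) n y : R := \sum_(0 <= i < n) v (iter i S y).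

Lemma birkhoff_sumS v n y :
  birkhoff_sum v n.+1 y = v y + birkhoff_sum v n (S y).
Proof.
rewrite /birkhoff_sum big_nat_recl//=; congr (_ + _).
by apply: eq_bigr => i _; rewrite -iterSr.
Qed.

Lemma bmeas_birkhoff_sum v n : bounded_measurable v ->
  bounded_measurable (birkhoff_sum v n).
Proof.
move=> bv; apply: bmeas_sum => i; apply: bmeas_comp bv.
exact: measurable_iter.
Qed.

(* [birkhoff_max v n] is the maximum of the Birkhoff sums of lengths 0, ..., n. *)
Fixpoint birkhoff_max (v : Y -> R) n y : R :=
  if n is n.+1 then Num.max 0 (v y + birkhoff_max v n (S y)) else 0.

Lemma birkhoff_max_ge0 v n y : 0 <= birkhoff_max v n y.
Proof. by case: n => //= n; rewrite le_max lexx. Qed.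

Lemma birkhoff_max_homo v n y : birkhoff_max v n y <= birkhoff_max v n.+1 y.
Proof.
elim: n y => [|n IH] y; first exact: birkhoff_max_ge0.
rewrite /= ge_max !le_max lexx /= lerD2l; apply/orP; right; exact: IH.
Qed.

Lemma birkhoff_sum_le_max v n y : birkhoff_sum v n y <= birkhoff_max v n y.
Proof.
elim: n y => [|n IH] y; first by rewrite /birkhoff_sum big_geq.
by rewrite birkhoff_sumS /= le_max lerD2l IH orbT.
Qed.

Lemma bmeas_birkhoff_max v n : bounded_measurable v ->
  bounded_measurable (birkhoff_max v n).
Proof.
move=> bv; elim: n => [|n IH] /=; first exact: bmeas_cst.
have [ms [M Ms]] := bmeasD bv (bmeas_comp S _ mS IH).
split; first exact: (measurable_maxr (measurable_cst _) ms).
exists M => y; apply: le_trans (Ms y).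
by case: (lerP 0 (v y + birkhoff_max v n (S y))) => h; rewrite ?normr0 ?normr_ge0.
Qed.

(** Garsia's argument: where [birkhoff_max v n] is positive, [v] is at least the difference of this
    maximum and its composition with [S]; elsewhere the difference is at most 0. Its integral
    vanishes by invariance, and the sets [pos n] increase to a set of full measure. *)
Lemma maximal_ergodic v : bounded_measurable v ->
  {ae P, forall y, exists n, 0 < birkhoff_sum v n y} -> 0 <= \int[P]_y v y.
Proof.
move=> bv vpos.
pose pos n := [set y | 0 < birkhoff_max v n y].
have mpos n : measurable (pos n).
  have [mM _] := bmeas_birkhoff_max v n bv.
  have := mM measurableT _ (measurable_itv `]0, +oo[).
  by rewrite setTI /preimage; under eq_set do rewrite /= in_itv/= andbT.
have bpos n : bounded_measurable (fun y => v y * \1_(pos n) y).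
  by apply: bmeasM => //; exact: bmeas_indic.
have int_ge0 n : 0 <= \int[P]_y (v y * \1_(pos n) y).
  have bM := bmeas_birkhoff_max v n bv.
  have bMS := bmeas_comp S _ mS bM.
  have <- : \int[P]_y (birkhoff_max v n y - birkhoff_max v n (S y)) = 0.
    by rewrite RintB// (Rint_invariant _ mS iS bM) subrr.
  apply: le_Rint => //; first exact: bmeasB.
  move=> y; rewrite indicE; have [|/negP ny] := boolP (y \in pos n).
    move/set_mem => py; rewrite mulr1 lerBlDr.
    case: n py {bpos mpos bM bMS} => [|n] py; first by rewrite /pos /= ltxx in py.
    move: py; rewrite /pos /= lt_max ltxx /= => py.
    rewrite (max_idPr (ltW py)) lerD2l -/(birkhoff_max v n.+1 (S y)).
    exact: birkhoff_max_homo.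
  rewrite mulr0; have -> : birkhoff_max v n y = 0.
    apply/eqP; rewrite eq_le birkhoff_max_ge0 andbT leNgt.
    by apply/negP => h; apply: ny; apply/mem_set.
  by rewrite sub0r oppr_le0 birkhoff_max_ge0.
have [mv [M vM]] := bv.
have H : \int[P]_y (v y * \1_(pos n) y) @[n --> \oo] --> \int[P]_y v y.
  apply: (Rint_bounded_cvg P (fun n y => v y * \1_(pos n) y) v M) => //.
  - by move=> n; case: (bpos n).
  - move=> n y; rewrite normrM; apply: le_trans (vM y).
    by rewrite ler_piMr// indicE normr_nat lern1 leq_b1.
  apply: filterS vpos => y [n yn].
  apply: (@cvg_trans _ ((fun=> v y) @ \oo)); last exact: cvg_cst.
  apply: near_eq_cvg; exists n => // p /= np.
  suff py : pos p y by rewrite indicE mem_set// mulr1.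
  rewrite /pos /=; apply: lt_le_trans yn _.
  apply: le_trans (birkhoff_sum_le_max v n y) _.
  rewrite -(subnK np); elim: (p - n)%N => // q IH.
  exact: le_trans IH (birkhoff_max_homo _ _ _).
rewrite -(cvg_lim (@Rhausdorff R) H); apply: limr_ge; first exact: cvgP H.
exact: nearW.
Qed.

Hypothesis ergS : ergodic_wrt S P.

(** The set [E] where the Birkhoff sums of [u - a] are unbounded above is invariant, hence null or
    full. If it were full, the maximal inequality would make the integral of [u - a] nonnegative. *)
Lemma birkhoff_upper u a : bounded_measurable u -> \int[P]_y u y < a ->
  {ae P, forall y, exists K : nat, forall n,
    birkhoff_sum u n y <= n%:R * a + K%:R}.
Proof.
move=> bu ua; pose v y : R := u y - a.
have bv : bounded_measurable v by apply: bmeasB => //; exact: bmeas_cst.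
have vE n y : birkhoff_sum v n y = birkhoff_sum u n y - n%:R * a.
  rewrite /birkhoff_sum sumrB; congr (_ - _).
  by rewrite big_const_nat iter_addr_0 subn0 mulr_natl.
have [mv [M vM]] := bv.
pose E := \bigcap_(K : nat) \bigcup_n [set y | K%:R < birkhoff_sum v n y].
have mE : measurable E.
  apply: bigcapT_measurable => K; apply: bigcup_measurable => n _.
  have [mM _] := bmeas_birkhoff_sum v n bv.
  have := mM measurableT _ (measurable_itv `]K%:R, +oo[).
  by rewrite setTI /preimage; under eq_set do rewrite /= in_itv/= andbT.
have EE y : E y <-> forall K : nat, exists n, K%:R < birkhoff_sum v n y.
  by split => [Ey K|H K _]; [have [n _ ?] := Ey K I|have [n ?] := H K];
    exists n.
have ES : S @^-1` E = E.
  apply/seteqP; split => y; rewrite /preimage/=; move=> /EE H; apply/EE => K.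
    (* Adding or dropping the first term moves the sum by at most [M], which the raised threshold
       absorbs. *)
    have [n b] := H (K + Num.truncn M).+1%N.
    exists n.+1; rewrite birkhoff_sumS.
    have := vM y; rewrite ler_norml => /andP[+ _].
    have := truncnS_gt M; move: b; rewrite -addnS natrD; lra.
  have [[|n]] := H (K + Num.truncn M).+1%N.
    by rewrite /birkhoff_sum big_geq// ltNge ler0n.
  rewrite birkhoff_sumS => b; exists n.
  have := vM y; rewrite ler_norml => /andP[_ +].
  have := truncnS_gt M; move: b; rewrite -addnS natrD; lra.
have [PE|PE] := ergS _ mE ES.
  exists E; split => // y /= ny; apply: contrapT => nE; apply: ny.
  move/EE : nE => /existsNP[K HK]; exists K => n.
  move/forallNP : HK => /(_ n)/negP; rewrite -leNgt vE; lra.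
suff : 0 <= \int[P]_y v y.
  by rewrite RintB ?Rint_cst//; [lra|exact: bmeas_cst].
apply: maximal_ergodic => //.
have PnE : P (~` E) = 0%E by rewrite probability_setC// PE subee.
exists (~` E); split => //; first exact: measurableC.
move=> y ny Ey; apply: ny; have [n yn] := (EE y).1 Ey 0%N.
by exists n.
Qed.

(** The one-sided bound is applied to [u] and to [-u] with slack [j.+1%:R^-1] for all [j] at once;
    the additive constants disappear after division by [n]. *)
Lemma birkhoff_ae u : bounded_measurable u ->
  {ae P, forall y, n%:R^-1 * birkhoff_sum u n y @[n --> \oo] --> \int[P]_y u y}.
Proof.
move=> bu.
have bNu : bounded_measurable (fun y => -1 * u y) by exact: bmeasZ.
have sumN n y : birkhoff_sum (fun y => -1 * u y) n y = - birkhoff_sum u n y.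
  by rewrite /birkhoff_sum -mulr_sumr mulN1r.
set c := \int[P]_y u y.
have up : {ae P, forall y, forall j : nat, exists K : nat, forall n,
    birkhoff_sum u n y <= n%:R * (c + j.+1%:R^-1) + K%:R}.
  apply/ae_foralln => j; apply: birkhoff_upper => //.
  by rewrite ltrDl invr_gt0 ltr0n.
have lo : {ae P, forall y, forall j : nat, exists K : nat, forall n,
    - birkhoff_sum u n y <= n%:R * (- c + j.+1%:R^-1) + K%:R}.
  apply/ae_foralln => j.
  have : \int[P]_y (-1 * u y) < - c + j.+1%:R^-1.
    by rewrite RintZ// mulN1r ltrDl invr_gt0 ltr0n.
  move=> /(birkhoff_upper _ _ bNu); apply: filterS => y [K HK]; exists K => n.
  by rewrite -sumN.
apply: filterS2 up lo => y Hup Hlo.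
apply/subr_cvg0; apply/cvgn0P => e e0.
pose j := Num.truncn (2 / e).
have je : j.+1%:R^-1 <= e / 2.
  rewrite -[leRHS]invrK lef_pV2 ?posrE ?ltr0n ?invr_gt0 ?divr_gt0//.
  by rewrite invf_div; apply/ltW; exact: truncnS_gt.
have [K1 H1] := Hup j; have [K2 H2] := Hlo j.
exists (Num.truncn (2 * (K1%:R + K2%:R) / e)).+1 => n nN.
have n0 : 0 < n%:R :> R by rewrite ltr0n (leq_trans _ nN).
have Kn : (K1%:R + K2%:R) <= n%:R * (e / 2).
  have : 2 * (K1%:R + K2%:R) / e <= n%:R.
    by apply: le_trans (ltW (truncnS_gt _)) _; rewrite ler_nat.
  by rewrite ler_pdivrMr//; lra.
have K10 : 0 <= K1%:R :> R by [].
have K20 : 0 <= K2%:R :> R by [].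
have jn : n%:R * j.+1%:R^-1 <= n%:R * (e / 2) by rewrite ler_wpM2l// ltW.
have -> : n%:R^-1 * birkhoff_sum u n y - c = (birkhoff_sum u n y - n%:R * c) / n%:R.
  by field; rewrite gt_eqF.
rewrite normrM [`|_^-1|]gtr0_norm ?invr_gt0// ler_pdivrMr// ler_norml.
have := H1 n; have := H2 n; rewrite !mulrDr mulrN => h1 h2.
move: jn h1 h2 Kn K10 K20; move: (n%:R * _^-1) => x.
move: (birkhoff_sum u n y) (K1%:R : R) (K2%:R : R) => s k1 k2.
move: (n%:R : R) n0 => q n0 *.
by apply/andP; split; lra.
Qed.

Lemma mean_ergodic u : bounded_measurable u ->
  \int[P]_y (n%:R^-1 * birkhoff_sum u n y - \int[P]_z u z) ^+ 2
    @[n --> \oo] --> 0.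
Proof.
move=> bu; set c := \int[P]_z u z.
have bA n : bounded_measurable (fun y => n%:R^-1 * birkhoff_sum u n y - c).
  by apply: bmeasB; [apply: bmeasZ; exact: bmeas_birkhoff_sum|exact: bmeas_cst].
have [mu [M uM]] := bu.
have M0 : 0 <= M := le_trans (normr_ge0 _) (uM point).
suff : \int[P]_y (n%:R^-1 * birkhoff_sum u n y - c) ^+ 2 @[n --> \oo] -->
    \int[P]_y (cst (0 : R) y) by rewrite [X in _ --> X -> _]Rint_cst.
apply: (Rint_bounded_cvg P (fun n y => (n%:R^-1 * birkhoff_sum u n y - c) ^+ 2)
  _ ((M + M) ^+ 2)).
- by move=> n; have [] := bmeasX 2 (bA n).
- move=> n y; rewrite normrX lerXn2r ?nnegrE ?addr_ge0//.
  apply: le_trans (ler_normB _ _) _; apply: lerD; last exact: Rint_norm_le.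
  rewrite normrM ger0_norm ?invr_ge0 ?ler0n//.
  have [->|n0] := posnP n; first by rewrite invr0 mul0r.
  rewrite mulrC ler_pdivrMr ?ltr0n//.
  apply: le_trans (ler_norm_sum _ _ _) _.
  apply: (@le_trans _ _ (\sum_(0 <= i < n) M)); first exact: ler_sum.
  by rewrite big_const_nat iter_addr_0 subn0 -[leLHS]mulr_natr.
- exact: measurable_cst.
apply: filterS (birkhoff_ae u bu) => y yc.
rewrite /cst -[X in _ --> X](_ : (c - c) ^+ 2 = 0); last by rewrite subrr expr0n.
have yc' : n%:R^-1 * birkhoff_sum u n y - c @[n --> \oo] --> c - c.
  by apply: cvgB => //; exact: cvg_cst.
under eq_fun do rewrite expr2.
by rewrite expr2; exact: cvgM.
Qed.

End mean_ergodic.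
Arguments birkhoff_sum {R d Y} S v n y.

(** * Averages along the orbit of the diagonal *)

Section cell_approximation.
Context {R : realType} {d : measure_display} {X : measurableType d} {k : nat}.

(* [f] is uniformly approximated by functions that are constant on the cells
   of a product of finite measurable partitions. *)
Definition cell_approx (f : k.-tuple X -> R) := forall e : R, 0 < e ->
  exists (Q : finType) (q : 'I_k -> X -> Q) (w : {ffun 'I_k -> Q} -> R),
  (forall i a, measurable (q i @^-1` [set a])) /\
  forall y, `|f y - w [ffun i => q i (tnth y i)]| <= e.

Lemma cell_approx_cst (c : R) : cell_approx (fun=> c).
Proof.
move=> e e0; exists unit, (fun _ _ => tt), (fun=> c); split => [i a|y].
  rewrite (_ : _ @^-1` _ = setT)//.
  by apply/seteqP; split => //= x _; case: a.
by rewrite subrr normr0 ltW.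
Qed.

(** The product type [Q * Q'] encodes the common refinement of the two partitions. *)
Lemma cell_approx2 (f g : k.-tuple X -> R) (op : R -> R -> R) :
  cell_approx f -> cell_approx g ->
  (forall e : R, 0 < e -> exists2 e' : R, 0 < e' &
    forall y a b, `|f y - a| <= e' -> `|g y - b| <= e' ->
    `|op (f y) (g y) - op a b| <= e) ->
  cell_approx (fun y => op (f y) (g y)).
Proof.
move=> af ag opc e e0; have [e' e'0 He] := opc e e0.
have [Q [q [w [mq qw]]]] := af e' e'0.
have [Q' [q' [w' [mq' qw']]]] := ag e' e'0.
exists (Q * Q')%type, (fun i x => (q i x, q' i x)),
  (fun c => op (w [ffun i => (c i).1]) (w' [ffun i => (c i).2])); split.
  move=> i [a a']; rewrite (_ : _ @^-1` _ =
    q i @^-1` [set a] `&` q' i @^-1` [set a']); first exact: measurableI.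
  by apply/seteqP; split => x /=; [move=> [-> ->]|move=> [-> ->]].
move=> y; apply: He.
  rewrite (_ : [ffun i => _] = [ffun i => q i (tnth y i)])//.
  by apply/ffunP => i; rewrite !ffunE.
rewrite (_ : [ffun i => _] = [ffun i => q' i (tnth y i)])//.
by apply/ffunP => i; rewrite !ffunE.
Qed.

Lemma cell_approxD f g : cell_approx f -> cell_approx g ->
  cell_approx (fun y => f y + g y).
Proof.
move=> af ag; apply: (cell_approx2 f g +%R af ag) => e e0.
exists (e / 2); first by rewrite divr_gt0.
move=> y a b fa gb; rewrite opprD addrACA (le_trans (ler_normD _ _))//; lra.
Qed.

Lemma cell_approxM f g : bounded_measurable f -> bounded_measurable g ->
  cell_approx f -> cell_approx g -> cell_approx (fun y => f y * g y).
Proof.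
move=> [_ [M fM]] [_ [L gL]] af ag; apply: (cell_approx2 f g *%R af ag) => e e0.
have M0 : 0 <= M := le_trans (normr_ge0 _) (fM point).
have L0 : 0 <= L := le_trans (normr_ge0 _) (gL point).
(* In the expansion of [f y * g y - a * b] below, the three terms are at most [M * e'], [L * e']
   and, since [e' <= 1], [e']. *)
pose e' := Num.min 1 (e / (M + L + 1)).
have D0 : 0 < M + L + 1 by lra.
have e'1 : e' <= 1 by rewrite /e' ge_min lexx.
have e'e : e' * (M + L + 1) <= e.
  by rewrite -ler_pdivlMr// /e' ge_min lexx orbT.
have e'0 : 0 < e' by rewrite /e' lt_min ltr01 divr_gt0.
exists e' => // y a b fa gb.
have -> : f y * g y - a * b =
    f y * (g y - b) + (f y - a) * g y - (f y - a) * (g y - b) by ring.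
have h1 : `|f y * (g y - b)| <= M * e' by rewrite normrM ler_pM.
have h2 : `|(f y - a) * g y| <= e' * L by rewrite normrM ler_pM.
have h3 : `|(f y - a) * (g y - b)| <= e' * 1.
  by rewrite normrM ler_pM// (le_trans gb).
apply: le_trans (ler_normB _ _) _.
apply: le_trans (lerD (ler_normD _ _) (lexx _)) _.
by apply: le_trans e'e; lra.
Qed.

(** The range of [f] is cut into half-open intervals of length [e], and [f] is replaced by the lower
    endpoint. *)
Lemma cell_approx_tnth (f : X -> R) (i : 'I_k) : bounded_measurable f ->
  cell_approx (fun y => f (tnth y i)).
Proof.
move=> [mf [M fM]] e e0.
pose s x := (f x + M) / e.
have s0 x : 0 <= s x.
  by apply: divr_ge0 (ltW e0); have := fM x; rewrite ler_norml => /andP[]; lra.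
pose L := Num.truncn (2 * M / e).
have sL x : (Num.truncn (s x) < L.+1)%N.
  rewrite ltnS /L; apply: le_truncn; rewrite /s ler_wpM2r ?invr_ge0 ?(ltW e0)//.
  by have := fM x; rewrite ler_norml => /andP[]; lra.
exists 'I_L.+1, (fun _ x => inord (Num.truncn (s x))),
  (fun c : {ffun 'I_k -> 'I_L.+1} => - M + (c i)%:R * e); split.
  move=> _ a; rewrite (_ : _ @^-1` _ = f @^-1` `[a%:R * e - M, a.+1%:R * e - M[).
    by rewrite -[X in measurable X]setTI; exact: mf.
  apply/seteqP; split => x /=; rewrite in_itv/=.
    move=> <-; rewrite inordK//.
    have /andP[] := truncn_itv (s0 x).
    rewrite {2}/s ler_pdivlMr// {2}/s ltr_pdivrMr// => h1 h2.
    by apply/andP; split; lra.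
  move=> /andP[h1 h2]; apply/val_inj; rewrite /= inordK//.
  apply/eqP; rewrite truncn_eq// /s ler_pdivlMr// ltr_pdivrMr//.
  by apply/andP; split; lra.
move=> y; rewrite ffunE inordK//.
have /andP[] := truncn_itv (s0 (tnth y i)).
rewrite {2}/s ler_pdivlMr// {2}/s ltr_pdivrMr// -natr1 mulrDl mul1r => h1 h2.
by rewrite ler_norml; apply/andP; split; lra.
Qed.

Lemma cell_approx_sum {I} (r : seq I) (f : I -> k.-tuple X -> R) :
  (forall i, cell_approx (f i)) ->
  cell_approx (fun y => \sum_(i <- r) f i y).
Proof.
move=> af; elim: r => [|i r IH].
  by under eq_fun do rewrite big_nil; exact: cell_approx_cst.
by under eq_fun do rewrite big_cons; exact: cell_approxD.
Qed.

Lemma cell_approx_prod {I} (r : seq I) (f : I -> k.-tuple X -> R) :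
  (forall i, bounded_measurable (f i)) -> (forall i, cell_approx (f i)) ->
  cell_approx (fun y => \prod_(i <- r) f i y).
Proof.
move=> bf af; elim: r => [|i r IH].
  by under eq_fun do rewrite big_nil; exact: cell_approx_cst.
under eq_fun do rewrite big_cons; apply: cell_approxM => //.
exact: bmeas_prod.
Qed.

End cell_approximation.

Lemma limn_esup_lt_near {R : realType} (u : (\bar R)^nat) (l : \bar R) :
  (limn_esup u < l)%E -> \forall n \near \oo, (u n < l)%E.
Proof.
move=> /ereal_inf_lt[_ /= [A Ao <-] Al]; apply: filterS Ao => n An.
by apply: le_lt_trans Al; apply: ereal_sup_ubound; exists n.
Qed.

(** Nonnegativity of the variance of [b 1, ..., b N]. *)
Lemma sqr_average_le {R : realType} (b : nat -> R) N : (0 < N)%N ->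
  (N%:R^-1 * \sum_(1 <= n < N.+1) b n) ^+ 2 <=
  N%:R^-1 * \sum_(1 <= n < N.+1) b n ^+ 2.
Proof.
move=> N0; have N0' : 0 < N%:R :> R by rewrite ltr0n.
set t := N%:R^-1 * \sum_(1 <= n < N.+1) b n.
have : 0 <= N%:R^-1 * \sum_(1 <= n < N.+1) (b n - t) ^+ 2.
  by rewrite mulr_ge0 ?invr_ge0 ?ler0n// sumr_ge0// => n _; exact: sqr_ge0.
suff -> : N%:R^-1 * \sum_(1 <= n < N.+1) (b n - t) ^+ 2 =
    N%:R^-1 * \sum_(1 <= n < N.+1) b n ^+ 2 - t ^+ 2 by rewrite subr_ge0.
have bE n : (b n - t) ^+ 2 = b n ^+ 2 - 2 * t * b n + t ^+ 2 by ring.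
under eq_bigr do rewrite bE.
rewrite big_split/= sumrB -mulr_sumr big_const_nat iter_addr_0 subSS subn0.
have -> : \sum_(1 <= n < N.+1) b n = N%:R * t by rewrite mulrA mulfV ?mul1r// gt_eqF.
rewrite -[t ^+ 2 *+ N]mulr_natl.
by field; rewrite gt_eqF.
Qed.

(** Each unit shift telescopes to two boundary terms. *)
Lemma sum_shift_dist {R : realType} (a : nat -> R) (K : R) N s :
  (forall n, `|a n| <= K) ->
  `|\sum_(0 <= n < N) a (n + s)%N - \sum_(0 <= n < N) a n| <= 2 * s%:R * K.
Proof.
move=> aK; elim: s => [|s IH].
  by under eq_bigr do rewrite addn0; rewrite subrr normr0 mulr0 mul0r.
have -> : \sum_(0 <= n < N) a (n + s.+1)%N - \sum_(0 <= n < N) a n =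
    \sum_(0 <= n < N) (a (n.+1 + s)%N - a (n + s)%N) +
    (\sum_(0 <= n < N) a (n + s)%N - \sum_(0 <= n < N) a n).
  rewrite sumrB addrA subrK; congr (_ - _).
  by apply: eq_bigr => n _; rewrite addSnnS.
rewrite (telescope_sumr (fun n => a (n + s)%N))//.
apply: le_trans (ler_normD _ _) _; rewrite -natr1.
have := ler_normB (a (N + s)%N) (a (0 + s)%N).
by have := aK (N + s)%N; have := aK (0 + s)%N; lra.
Qed.

Section diagonal_averages.
Context {R : realType} {d : measure_display} {X : measurableType d} {k : nat}.
Context {mu : probability X R} {T : 'I_k -> X -> X}.
Context {m : 'I_k -> probability X R} {nu : probability (k.-tuple X) R}.
Hypothesis mT : forall i, measurable_fun [set: X] (T i).
Hypothesis nuP : is_product_measure nu m.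

(** The [n]-th point of the orbit of the diagonal point (x, ..., x) under the product map. *)
Definition diag_orbit n (x : X) : k.-tuple X := [tuple iter n (T i) x | i < k].

Lemma measurable_diag_orbit n : measurable_fun [set: X] (diag_orbit n).
Proof.
apply/measurable_fun_tnthP => i.
rewrite [X in measurable_fun _ X](_ : _ = iter n (T i)).
  exact: measurable_iter.
by apply/funext => x /=; rewrite tnth_mktuple.
Qed.

Lemma measure_diag_orbit n (A : 'I_k -> set X) :
  (forall i, measurable (A i)) ->
  mu [set x | forall i, A i (iter n (T i) x)] =
  (\int[mu]_x \1_(box A) (diag_orbit n x))%:E.
Proof.
move=> mA.
have mpre : measurable (diag_orbit n @^-1` box A).
  rewrite -[X in measurable X]setTI; apply: measurable_diag_orbit => //.
  exact: measurable_box.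
rewrite (_ : [set x | _] = diag_orbit n @^-1` box A); last first.
  by apply/seteqP; split => x /= H i; have := H i; rewrite tnth_mktuple.
have -> : \int[mu]_x \1_(box A) (diag_orbit n x) =
    \int[mu]_x \1_(diag_orbit n @^-1` box A) x by [].
by rewrite Rint_indic// fineK// fin_num_measure.
Qed.

Definition diag_average N (f : k.-tuple X -> R) : R :=
  N%:R^-1 * \sum_(1 <= n < N.+1) \int[mu]_x f (diag_orbit n x).

Lemma bmeas_diag_orbit n (f : k.-tuple X -> R) : bounded_measurable f ->
  bounded_measurable (fun x => f (diag_orbit n x)).
Proof. exact/bmeas_comp/measurable_diag_orbit. Qed.

Lemma le_diag_average N f g : bounded_measurable f -> bounded_measurable g ->
  (forall y, f y <= g y) -> diag_average N f <= diag_average N g.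
Proof.
move=> bf bg fg; apply: ler_wpM2l; first by rewrite invr_ge0 ler0n.
by apply: ler_sum => n _; apply: le_Rint => //; exact: bmeas_diag_orbit.
Qed.

Lemma diag_averageD N f g : bounded_measurable f -> bounded_measurable g ->
  diag_average N (fun y => f y + g y) = diag_average N f + diag_average N g.
Proof.
move=> bf bg; rewrite /diag_average -mulrDr -big_split/=.
by congr (_ * _); apply: eq_bigr => n _; rewrite RintD//; exact: bmeas_diag_orbit.
Qed.

Lemma diag_averageZ N c f : bounded_measurable f ->
  diag_average N (fun y => c * f y) = c * diag_average N f.
Proof.
move=> bf; rewrite /diag_average mulrCA; congr (_ * _); rewrite mulr_sumr.
by apply: eq_bigr => n _; rewrite RintZ//; exact: bmeas_diag_orbit.
Qed.

Lemma diag_average_sum N I (r : seq I) (f : I -> k.-tuple X -> R) :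
  (forall i, bounded_measurable (f i)) ->
  diag_average N (fun y => \sum_(i <- r) f i y) = \sum_(i <- r) diag_average N (f i).
Proof.
move=> bf; rewrite /diag_average -mulr_sumr exchange_big/=; congr (_ * _).
by apply: eq_bigr => n _; rewrite Rint_sum// => i; exact: bmeas_diag_orbit.
Qed.

(** Only an inequality, since the average is 0 at [N = 0]. *)
Lemma diag_average_cst_le N (c : R) : 0 <= c -> diag_average N (fun=> c) <= c.
Proof.
move=> c0; rewrite /diag_average; under eq_bigr do rewrite Rint_cst.
rewrite big_const_nat iter_addr_0 subSS subn0 -[c *+ N]mulr_natl mulrA.
have [->|N0] := posnP N; first by rewrite invr0 !mul0r.
by rewrite mulVf ?mul1r// pnatr_eq0 -lt0n.
Qed.

Variable C : R.
Hypothesis C0 : 0 < C.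
Hypothesis limsup_box : forall A : 'I_k -> set X, (forall i, measurable (A i)) ->
  (limn_esup (fun N : nat => (N%:R^-1)%:E * \sum_(1 <= n < N.+1)
     mu [set x | forall i, A i (iter n (T i) x)]) <= C%:E * \prod_(i < k) m i (A i))%E.

Lemma diag_average_box (A : 'I_k -> set X) (e : R) :
  (forall i, measurable (A i)) -> 0 < e ->
  \forall N \near \oo, diag_average N \1_(box A) <=
    C * \int[nu]_y \1_(box A) y + e.
Proof.
move=> mA e0; have mbA := measurable_box A mA.
have nuE : (\prod_(i < k) m i (A i))%E = (\int[nu]_y \1_(box A) y)%:E.
  by rewrite -nuP// Rint_indic// fineK// fin_num_measure.
have := limsup_box A mA; rewrite nuE -EFinM => H.
have : (limn_esup (fun N : nat => (N%:R^-1)%:E * \sum_(1 <= n < N.+1)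
     mu [set x | forall i, A i (iter n (T i) x)]) <
     (C * \int[nu]_y \1_(box A) y + e)%:E)%E.
  by apply: le_lt_trans H _; rewrite lte_fin ltrDl.
move=> /limn_esup_lt_near; apply: filterS => N.
rewrite (_ : (_ * _)%E = (diag_average N \1_(box A))%:E).
  by rewrite lte_fin => /ltW.
rewrite /diag_average EFinM -sumEFin; congr (_ * _)%E; apply: eq_bigr => n _.
exact: measure_diag_orbit.
Qed.

(** [W] is a finite combination of indicators of boxes with nonnegative weights, so the box bounds
    add up. *)
Lemma diag_average_cell (Q : finType) (q : 'I_k -> X -> Q)
    (w : {ffun 'I_k -> Q} -> R) (e : R) :
  (forall i a, measurable (q i @^-1` [set a])) -> (forall c, 0 <= w c) -> 0 < e ->
  let W y := w [ffun i => q i (tnth y i)] in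
  bounded_measurable W /\
  \forall N \near \oo, diag_average N W <= C * \int[nu]_y W y + e.
Proof.
move=> mq w0 e0 W.
pose A (c : {ffun 'I_k -> Q}) := box (fun i => q i @^-1` [set c i]).
have bA c : bounded_measurable (\1_(A c) : k.-tuple X -> R).
  by apply: bmeas_indic; exact: measurable_box.
have bwA c : bounded_measurable (fun y => w c * \1_(A c) y) by exact: bmeasZ.
have WE : W = fun y => \sum_c w c * \1_(A c) y.
  apply/funext => y; rewrite (bigD1 [ffun i => q i (tnth y i)])//= big1 => [|c cy].
    rewrite addr0 indicE mem_set ?mulr1//= => i.
    by rewrite /preimage/= ffunE.
  rewrite indicE memNset ?mulr0// => yc; move/eqP: cy; apply.
  by apply/ffunP => i; rewrite ffunE (yc i).
have bW : bounded_measurable W by rewrite WE; exact: bmeas_sum.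
split => //; pose D := 1 + \sum_c w c.
have D0 : 0 < D by rewrite /D ltr_wpDr// sumr_ge0.
have Hc c : \forall N \near \oo,
    diag_average N \1_(A c) <= C * \int[nu]_y \1_(A c) y + e / D.
  by apply: diag_average_box => //; exact: divr_gt0.
have Hall : \forall N \near \oo, forall c,
    diag_average N \1_(A c) <= C * \int[nu]_y \1_(A c) y + e / D.
  exact: filter_forall Hc.
move: Hall.
apply: filterS => N HN; rewrite WE diag_average_sum// Rint_sum// mulr_sumr.
apply: (@le_trans _ _ (\sum_c (C * \int[nu]_y (w c * \1_(A c) y) + w c * (e / D)))).
  apply: ler_sum => c _; rewrite diag_averageZ// RintZ// [C * _]mulrCA -mulrDr.
  exact: ler_wpM2l.
rewrite big_split/= lerD2l -mulr_suml mulrA ler_pdivrMr// mulrC ler_wpM2l ?(ltW e0)//.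
by rewrite /D lerDr.
Qed.

Lemma diag_average_sqr (g : k.-tuple X -> R) (e : R) : bounded_measurable g ->
  cell_approx g -> 0 < e ->
  \forall N \near \oo, diag_average N (fun y => g y ^+ 2) <=
    4 * C * \int[nu]_y (g y ^+ 2) + e.
Proof.
move=> bg ag e0.
(* The two approximations below contribute [(4 * C + 2) * de <= e / 2], and the bound on cells the
   other [e / 2]. *)
pose de := Num.min 1 (e / (8 * C + 4)).
have E0 : 0 < 8 * C + 4 by rewrite addr_gt0// mulr_gt0.
have de1 : de <= 1 by rewrite /de ge_min lexx.
have dee : de * (8 * C + 4) <= e.
  by rewrite -ler_pdivlMr// /de ge_min lexx orbT.
have de0 : 0 < de by rewrite /de lt_min ltr01 divr_gt0.
have [Q [q [w [mq gw]]]] := ag de de0.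
pose W y := w [ffun i => q i (tnth y i)] ^+ 2.
have [bW] := diag_average_cell Q q (fun c => w c ^+ 2) (e / 4) mq
  (fun=> sqr_ge0 _) ltac:(lra).
have bg2 : bounded_measurable (fun y => g y ^+ 2) by exact: bmeasX.
have de2 : de ^+ 2 <= de by rewrite expr2 -[leRHS]mulr1 ler_wpM2l// ltW.
(* Comparing [g ^+ 2] and [W] in both directions costs a factor 2 each time, hence the factor 4 in
   the conclusion. *)
have sqr_le (a b : R) : `|a - b| <= de -> a ^+ 2 <= 2 * b ^+ 2 + 2 * de.
  move=> ab; have : (a - b) ^+ 2 <= de ^+ 2.
    by rewrite -[X in X <= _]real_normK ?num_real// lerXn2r ?nnegrE ?(ltW de0).
  have := sqr_ge0 (a - 2 * b); move: de2; rewrite !expr2; lra.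
have gW y : g y ^+ 2 <= 2 * W y + 2 * de by exact: sqr_le.
have Wg y : W y <= 2 * g y ^+ 2 + 2 * de by apply: sqr_le; rewrite distrC.
have bWd : bounded_measurable (fun y => 2 * W y + 2 * de).
  by apply: bmeasD; [exact: bmeasZ|exact: bmeas_cst].
have intW : \int[nu]_y W y <= 2 * \int[nu]_y (g y ^+ 2) + 2 * de.
  rewrite -RintZ// -[X in _ + X](Rint_cst nu) -RintD.
  - apply: le_Rint => //; apply: bmeasD; [exact: bmeasZ|exact: bmeas_cst].
  - exact: bmeasZ.
  - exact: bmeas_cst.
apply: filterS => N HN.
apply: le_trans (le_diag_average N _ _ bg2 bWd gW) _.
rewrite diag_averageD; [|exact: bmeasZ|exact: bmeas_cst].
rewrite diag_averageZ//.
have := diag_average_cst_le N (2 * de) ltac:(lra).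
have := ler_wpM2l (ltW C0) intW.
rewrite -/W in HN; move: HN dee; lra.
Qed.

End diagonal_averages.
Arguments diag_orbit {d X k} T n x.
Arguments diag_average {R d X k} mu T N f.

(** * From the limsup bound to convergence in L^2 *)

Section limsup_joint_ergodicity.
Context {R : realType} {d : measure_display} {X : measurableType d} {k : nat}.
Context {mu : probability X R} {T : 'I_k -> X -> X}.
Context {m : 'I_k -> probability X R} {nu : probability (k.-tuple X) R}.
Hypothesis mT : forall i, measurable_fun [set: X] (T i).
Hypothesis iT : forall i, is_invariant (T i) (m i).
Hypothesis nuP : is_product_measure nu m.
Hypothesis ergT : ergodic_wrt (prod_map T) nu.
Variable C : R.
Hypothesis C0 : 0 < C.
Hypothesis limsup_box : forall A : 'I_k -> set X, (forall i, measurable (A i)) ->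
  (limn_esup (fun N : nat => (N%:R^-1)%:E * \sum_(1 <= n < N.+1)
     mu [set x | forall i, A i (iter n (T i) x)]) <= C%:E * \prod_(i < k) m i (A i))%E.

Lemma limsup_joint_ergodic (f : 'I_k -> X -> R) :
  (forall i, bounded_measurable (f i)) ->
  (fun N : nat => \int[mu]_x
     ((N%:R^-1 * \sum_(0 <= n < N) \prod_(i < k) f i (iter n (T i) x)
       - \prod_(i < k) \int[m i]_x f i x) ^+ 2)) @ \oo --> 0.
Proof.
move=> bf; set c := \prod_(i < k) \int[m i]_x f i x.
pose u (y : k.-tuple X) : R := \prod_(i < k) f i (tnth y i).
have bu : bounded_measurable u by apply: bmeas_prod => i; exact: bmeas_tnth.
have uc : \int[nu]_y u y = c by exact: Rint_prod_tuple.
pose a n x : R := \prod_(i < k) f i (iter n (T i) x) - c.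
have uE p n x : u (iter p (prod_map T) (diag_orbit T n x)) - c = a (n + p)%N x.
  congr (_ - _); apply: eq_bigr => i _.
  by rewrite tnth_iter_prod_map tnth_mktuple addnC iterD.
have aE n x : a n x = u (diag_orbit T n x) - c by rewrite (uE 0%N) addn0.
have ba n : bounded_measurable (a n).
  apply: bmeasB (bmeas_cst c); apply: bmeas_prod => i.
  by apply: bmeas_comp (bf i); exact: measurable_iter.
have [K K0 aK] : exists2 K : R, 0 <= K & forall n x, `|a n x| <= K.
  have [_ [L uL]] := bmeasB bu (bmeas_cst c).
  by exists L => [|n x]; [exact: le_trans (uL point)|rewrite aE].
pose g M (y : k.-tuple X) : R := M%:R^-1 * birkhoff_sum (prod_map T) u M y - c.
have mS := measurable_prod_map mT.
have iS := product_measure_invariant nuP mT iT.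
have bg M : bounded_measurable (g M).
  apply: bmeasB (bmeas_cst c); apply: bmeasZ.
  exact: (bmeas_birkhoff_sum mS).
have ag M : cell_approx (g M).
  apply: cell_approxD (cell_approx_cst _).
  apply: cell_approxM; [exact: bmeas_cst|exact: (bmeas_birkhoff_sum mS)|
    exact: cell_approx_cst|].
  apply: cell_approx_sum => p.
  have bfp i : bounded_measurable (fun x => f i (iter p (T i) x)).
    by apply: bmeas_comp (bf i); exact: measurable_iter.
  rewrite (_ : (fun y => _) =
      fun y => \prod_(i < k) f i (iter p (T i) (tnth y i))); last first.
    by apply/funext => y; apply: eq_bigr => i _; rewrite tnth_iter_prod_map.
  apply: cell_approx_prod => i; first exact: (bmeas_tnth (fun x => f i (iter p (T i) x))).
  exact: (cell_approx_tnth (fun x => f i (iter p (T i) x))).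
apply/cvgn0P => e e0.
(* With this constant, [4 * C] times the integral is at most [e / 8]; the diagonal bound adds
   [e / 8], and the doubling at the end gives [e / 2]. *)
have [M M0 HM] : exists2 M, (0 < M)%N & \int[nu]_y (g M y ^+ 2) <= e / (32 * C).
  have /cvgn0P H := mean_ergodic mS iS ergT _ bu.
  have [M HM] := H (e / (32 * C)) ltac:(by rewrite divr_gt0// mulr_gt0).
  exists M.+1 => //; have := HM _ (leqnSn M); rewrite uc.
  by apply: le_trans; exact: ler_norm.
have HM' : 4 * C * \int[nu]_y (g M y ^+ 2) <= e / 8.
  by move: HM; rewrite ler_pdivlMr ?mulr_gt0//; lra.
have [N0 _ HN0] := diag_average_sqr mT nuP C C0 limsup_box _ (e / 8) (bg M) (ag M)
  ltac:(lra).
(* [D] bounds the change of a sum of [N] consecutive values of [a] under a shift by at most [M]. *)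
pose D : R := 2 * M%:R * K.
have D0 : 0 <= D by rewrite !mulr_ge0.
exists (maxn N0 (Num.truncn (4 * D ^+ 2 / e)).+1) => N.
rewrite geq_max => /andP[/HN0 {}HN0 HND].
have N0' : 0 < N%:R :> R by rewrite ltr0n (leq_trans _ HND).
have Nn0 : N%:R != 0 :> R by rewrite gt_eqF.
have Mn0 : M%:R != 0 :> R by rewrite pnatr_eq0 -lt0n.
have DN : (D / N%:R) ^+ 2 <= e / 4.
  have h1 : 4 * D ^+ 2 / e <= N%:R.
    by apply: le_trans (ltW (truncnS_gt _)) _; rewrite ler_nat.
  have N1 : 1 <= N%:R :> R by rewrite ler1n (leq_trans _ HND).
  have h2 : N%:R <= N%:R ^+ 2 :> R by rewrite expr2 -[leLHS]mulr1 ler_wpM2l.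
  rewrite expr_div_n ler_pdivrMr ?exprn_gt0//.
  move: h1; rewrite ler_pdivrMr// => h1.
  have : e * N%:R <= e * N%:R ^+ 2 by rewrite ler_wpM2l ?(ltW e0).
  by lra.
pose G x : R := N%:R^-1 * \sum_(1 <= n < N.+1) g M (diag_orbit T n x).
have AE x : N%:R^-1 * \sum_(0 <= n < N) \prod_(i < k) f i (iter n (T i) x) - c =
    N%:R^-1 * \sum_(0 <= n < N) a n x.
  rewrite sumrB big_const_nat iter_addr_0 subn0 -[c *+ N]mulr_natl mulrBr.
  by rewrite mulKf.
have gE n x : g M (diag_orbit T n x) = M%:R^-1 * \sum_(0 <= p < M) a (n + p)%N x.
  under eq_bigr do rewrite -uE.
  rewrite sumrB big_const_nat iter_addr_0 subn0 -[c *+ M]mulr_natl mulrBr.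
  by rewrite mulKf.
have GA x : `|N%:R^-1 * \sum_(0 <= n < N) a n x - G x| <= D / N%:R.
  rewrite distrC /G; under eq_bigr do rewrite gE.
  rewrite -mulr_sumr exchange_big/= -mulrBr normrM.
  rewrite [`|_^-1|]gtr0_norm ?invr_gt0// mulrC ler_wpM2r ?invr_ge0 ?ler0n//.
  set A := \sum_(0 <= n < N) a n x.
  (* The sum over [n] starts at 1, so the shift is [p.+1], which is still at most [M]. *)
  have -> : M%:R^-1 * \sum_(0 <= p < M) \sum_(1 <= n < N.+1) a (n + p)%N x - A =
     M%:R^-1 * \sum_(0 <= p < M) (\sum_(0 <= n < N) a (n + p.+1)%N x - A).
    rewrite [in RHS]sumrB big_const_nat iter_addr_0 subn0 -[A *+ M]mulr_natl.
    rewrite mulrBr mulKf//; congr (_ * _ - _); apply: eq_bigr => p _.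
    by rewrite big_add1/=; apply: eq_bigr => n _; rewrite addSnnS.
  rewrite normrM gtr0_norm ?invr_gt0 ?ltr0n// mulrC ler_pdivrMr ?ltr0n//.
  apply: le_trans (ler_norm_sum _ _ _) _.
  apply: (@le_trans _ _ (\sum_(0 <= p < M) D)); last first.
    by rewrite big_const_nat iter_addr_0 subn0 -[leLHS]mulr_natr.
  rewrite !big_nat; apply: ler_sum => p /andP[_ pM].
  apply: le_trans (sum_shift_dist (fun n => a n x) K N p.+1 _) _ => //.
  by rewrite /D ler_wpM2r// ler_wpM2l// ler_nat.
have bG : bounded_measurable (fun x => N%:R^-1 *
    \sum_(1 <= n < N.+1) g M (diag_orbit T n x) ^+ 2).
  apply: bmeasZ; apply: bmeas_sum => n; apply: bmeasX.
  by apply: bmeas_comp (bg M); exact: measurable_diag_orbit.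
have bA : bounded_measurable (fun x => N%:R^-1 * \sum_(0 <= n < N) a n x).
  by apply: bmeasZ; exact: bmeas_sum.
rewrite ger0_norm; last by apply: Rintegral_ge0 => x _; exact: sqr_ge0.
under eq_Rintegral do rewrite AE.
(* The square of the average [A] is at most [2 * B ^+ 2 + 2 * (A - B) ^+ 2] with [B = G x];
   convexity bounds [B ^+ 2]. *)
have E x : (N%:R^-1 * \sum_(0 <= n < N) a n x) ^+ 2 <=
    2 * (N%:R^-1 * \sum_(1 <= n < N.+1) g M (diag_orbit T n x) ^+ 2) + e / 2.
  have h := GA x; have hG := sqr_average_le (fun n => g M (diag_orbit T n x)) N
    ltac:(by rewrite (leq_trans _ HND)).
  have h' : (N%:R^-1 * \sum_(0 <= n < N) a n x - G x) ^+ 2 <= (D / N%:R) ^+ 2.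
    rewrite -[leLHS]real_normK ?num_real// lerXn2r ?nnegrE//.
    by rewrite divr_ge0// ltW.
  move: h' hG DN; rewrite -/(G x).
  move: (N%:R^-1 * \sum_(0 <= n < N) a n x) (G x) => A B h' hG DN.
  have := sqr_ge0 (A - 2 * B); move: h' hG DN; rewrite !expr2; lra.
apply: le_trans (le_Rint mu (bmeasX 2 bA) (bmeasD (bmeasZ 2 bG) (bmeas_cst (e / 2))) E) _.
rewrite RintD; [|exact: bmeasZ|exact: bmeas_cst].
rewrite Rint_cst RintZ//.
have -> : \int[mu]_x (N%:R^-1 * \sum_(1 <= n < N.+1) g M (diag_orbit T n x) ^+ 2) =
    diag_average mu T N (fun y => g M y ^+ 2).
  have bgn n : bounded_measurable (fun x => g M (diag_orbit T n x) ^+ 2).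
    by apply: bmeasX; apply: bmeas_comp (bg M); exact: measurable_diag_orbit.
  by rewrite RintZ ?Rint_sum//; exact: bmeas_sum.
by move: HN0 HM'; rewrite /=; lra.
Qed.

End limsup_joint_ergodicity.

(** * The equivalence *)

Section joint_ergodicity_implications.
Context {R : realType} {d : measure_display} {X : measurableType d} {k : nat}.
Context {mu : probability X R} {T : 'I_k -> X -> X}.
Context {m : 'I_k -> probability X R}.
Hypothesis mT : forall i, measurable_fun [set: X] (T i).

(** Cauchy-Schwarz pairs [f0] with the L^2 error. The two averages run over different ranges, 0 to N
    - 1 and 1 to N, which costs a boundary term of order 1 / N. *)
Lemma joint_ergodic_weak_cvg (f0 : X -> R) (f : 'I_k -> X -> R) :
  bounded_measurable f0 -> (forall i, bounded_measurable (f i)) ->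
  (fun N : nat => \int[mu]_x
     ((N%:R^-1 * \sum_(0 <= n < N) \prod_(i < k) f i (iter n (T i) x)
       - \prod_(i < k) \int[m i]_x f i x) ^+ 2)) @ \oo --> 0 ->
  (fun N : nat => N%:R^-1 * \sum_(1 <= n < N.+1)
     \int[mu]_x (f0 x * \prod_(i < k) f i (iter n (T i) x)))
  @ \oo --> \int[mu]_x f0 x * \prod_(i < k) \int[m i]_x f i x.
Proof.
move=> bf0 bf; set c := \prod_(i < k) \int[m i]_x f i x.
pose u n x : R := \prod_(i < k) f i (iter n (T i) x).
have bu n : bounded_measurable (u n).
  by apply: bmeas_prod => i; apply: bmeas_comp (bf i); exact: measurable_iter.
pose W N x : R := N%:R^-1 * \sum_(0 <= n < N) u n x - c.
have bW N : bounded_measurable (W N).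
  by apply: bmeasB (bmeas_cst c); apply: bmeasZ; exact: bmeas_sum.
move=> L2; apply/subr_cvg0/cvgn0P => e e0.
have [_ [K0 f0K]] := bf0.
have [K uK] : exists K : R, forall n x, `|u n x| <= K.
  have [F FP] := choice (fun i => proj2 (bf i)).
  exists (\prod_(i < k) F i) => n x; rewrite normr_prod.
  by apply: ler_prod => i _; rewrite normr_ge0 FP.
have K00 : 0 <= K0 := le_trans (normr_ge0 _) (f0K point).
have K0' : 0 <= K := le_trans (normr_ge0 _) (uK 0%N point).
pose a n : R := \int[mu]_x (f0 x * u n x).
have bfu n : bounded_measurable (fun x => f0 x * u n x) by exact: bmeasM.
have aK n : `|a n| <= K0 * K.
  apply: Rint_norm_le => [|x]; first by case: (bfu n).
  by rewrite normrM ler_pM.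
set I0 := \int[mu]_x (f0 x ^+ 2).
have I00 : 0 <= I0 by apply: Rintegral_ge0 => x _; exact: sqr_ge0.
have De : 0 < (e / 2) ^+ 2 / (I0 + 1) by rewrite divr_gt0 ?exprn_gt0 ?divr_gt0 ?ltr_wpDl.
have [N0 HN0] := (cvgn0P _).1 L2 _ De.
exists (maxn N0 (Num.truncn (4 * (K0 * K) / e)).+1) => N.
rewrite geq_max => /andP[/HN0 {}HN0 HND].
have N0' : 0 < N%:R :> R by rewrite ltr0n (leq_trans _ HND).
have KN : 2 * (K0 * K) / N%:R <= e / 2.
  have h : 4 * (K0 * K) / e <= N%:R.
    by apply: le_trans (ltW (truncnS_gt _)) _; rewrite ler_nat.
  by rewrite ler_pdivrMr//; move: h; rewrite ler_pdivrMr//; lra.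
have shift : `|N%:R^-1 * \sum_(1 <= n < N.+1) a n -
    N%:R^-1 * \sum_(0 <= n < N) a n| <= e / 2.
  rewrite -mulrBr normrM gtr0_norm ?invr_gt0// mulrC; apply: le_trans KN.
  rewrite ler_wpM2r ?invr_ge0 ?ler0n// big_add1/=.
  have := sum_shift_dist a (K0 * K) N 1 aK; rewrite mulr1.
  by under [X in `|X - _|]eq_bigr do rewrite addn1.
have J : \int[mu]_x (f0 x * W N x) =
    N%:R^-1 * \sum_(0 <= n < N) a n - \int[mu]_x f0 x * c.
  transitivity (\int[mu]_x (N%:R^-1 * \sum_(0 <= n < N) (f0 x * u n x) - c * f0 x)).
    apply: eq_Rintegral => x _; rewrite /W -mulr_sumr; ring.
  have bS : bounded_measurable (fun x => \sum_(0 <= n < N) (f0 x * u n x)).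
    exact: bmeas_sum.
  rewrite RintB; [|exact: bmeasZ|exact: bmeasZ].
  by rewrite !RintZ// Rint_sum// [c * _]mulrC.
have CS : `|\int[mu]_x (f0 x * W N x)| <= e / 2.
  rewrite -ler_sqr ?nnegrE ?normr_ge0 ?divr_ge0 ?(ltW e0)//.
  rewrite real_normK ?num_real//; apply: le_trans (Rint_CauchySchwarz mu bf0 (bW N)) _.
  have h : \int[mu]_x (W N x ^+ 2) <= (e / 2) ^+ 2 / (I0 + 1).
    by apply: le_trans HN0; exact: ler_norm.
  apply: le_trans (ler_wpM2l I00 h) _.
  rewrite mulrCA ler_piMr ?sqr_ge0// ler_pdivrMr ?ltr_wpDl// mul1r lerDl//.
rewrite (_ : _ - _ = (N%:R^-1 * \sum_(1 <= n < N.+1) a n -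
    N%:R^-1 * \sum_(0 <= n < N) a n) + \int[mu]_x (f0 x * W N x)).
  by apply: le_trans (ler_normD _ _) _; lra.
by rewrite J /a /u; ring.
Qed.

(** A convergent sequence has its limit as limsup; the rest translates integrals of indicators into
    extended-real measures. *)
Lemma cvg_limn_esup_box (A : 'I_k -> set X) :
  (forall i, measurable (A i)) ->
  (fun N : nat => N%:R^-1 * \sum_(1 <= n < N.+1)
     \int[mu]_x \prod_(i < k) \1_(A i) (iter n (T i) x))
  @ \oo --> \prod_(i < k) \int[m i]_x \1_(A i) x ->
  limn_esup (fun N : nat => (N%:R^-1)%:E * \sum_(1 <= n < N.+1)
    mu [set x | forall i, A i (iter n (T i) x)])%E = (\prod_(i < k) m i (A i))%E.
Proof.
move=> mA H; set u := (X in X @ \oo --> _) in H.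
have -> : (\prod_(i < k) m i (A i))%E = (\prod_(i < k) \int[m i]_x \1_(A i) x)%:E.
  rewrite -prodEFin; apply: eq_bigr => i _.
  by rewrite Rint_indic// fineK// fin_num_measure.
have uE : EFin \o u @ \oo --> (\prod_(i < k) \int[m i]_x \1_(A i) x)%:E.
  by apply: cvg_EFin => //; exact: nearW.
rewrite -(cvg_limn_einf_sup uE).2; congr limn_esup; apply/funext => N; rewrite /= EFinM -sumEFin; congr (_ * _)%E.
apply: eq_bigr => n _; rewrite measure_diag_orbit//; congr (_%:E).
apply: eq_Rintegral => x _; rewrite indic_box.
by apply: eq_bigr => i _; rewrite tnth_mktuple.
Qed.

End joint_ergodicity_implications.

Theorem theorem7p3 (R : realType) (X : pseudoPMetricType R)
  (Xhaus : hausdorff_space X) (Xcpt : compact [set: X])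
  (mu : probability (borel X) R) (k : nat)
  (T : 'I_k -> borel X -> borel X)
  (mus : 'I_k -> probability (borel X) R)
  (Tmeas : forall i, measurable_fun [set: borel X] (T i))
  (Tinv : forall i, is_invariant (T i) (mus i))
  (Teqv : forall i, equiv_measures (mus i) mu) :
  let ergprod := forall nu : probability (k.-tuple (borel X)) R,
      is_product_measure nu mus -> ergodic_wrt (prod_map T) nu in
  [<->
  (* (i) joint ergodicity: L^2(mu) convergence of the averages *)
    (forall f : 'I_k -> borel X -> R, (forall i, bounded_measurable (f i)) ->
       (fun N : nat => Rintegral mu [set: borel X] (fun x =>
          (N%:R^-1 * \sum_(0 <= n < N) \prod_(i < k) f i (iter n (T i) x)
           - \prod_(i < k) Rintegral (mus i) [set: borel X] (f i)) ^+ 2))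
       @ \oo --> 0);
  (* (ii) *)
    (forall (f0 : borel X -> R) (f : 'I_k -> borel X -> R),
       bounded_measurable f0 -> (forall i, bounded_measurable (f i)) ->
       (fun N : nat => N%:R^-1 * \sum_(1 <= n < N.+1)
          Rintegral mu [set: borel X]
            (fun x => f0 x * \prod_(i < k) f i (iter n (T i) x)))
       @ \oo --> (Rintegral mu [set: borel X] f0 *
                  \prod_(i < k) Rintegral (mus i) [set: borel X] (f i)));
  (* (iii) *)
    (ergprod /\
     forall f : 'I_k -> borel X -> R, (forall i, bounded_measurable (f i)) ->
       (fun N : nat => N%:R^-1 * \sum_(1 <= n < N.+1)
          Rintegral mu [set: borel X]
            (fun x => \prod_(i < k) f i (iter n (T i) x)))
       @ \oo --> \prod_(i < k) Rintegral (mus i) [set: borel X] (f i));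
  (* (iv) *)
    (ergprod /\
     exists C : R, 0 < C /\
       forall A : 'I_k -> set (borel X), (forall i, measurable (A i)) ->
         (limn_esup (fun N : nat => (N%:R^-1)%:E * \sum_(1 <= n < N.+1)
             mu [set x | forall i, A i (iter n (T i) x)]) <=
          C%:E * \prod_(i < k) mus i (A i))%E)
  ].
Proof.
move=> ergprod; tfae.
- move=> L2 f0 f bf0 bf; exact: joint_ergodic_weak_cvg (L2 f bf).
- move=> weak; split=> [nu nuP|f bf].
    exact: weak_cvg_prod_ergodic Tmeas Tinv nuP weak.
  have := weak (fun=> 1) f (bmeas_cst 1) bf; rewrite Rint_cst mul1r.
  by under eq_fun do under eq_bigr do under eq_Rintegral do rewrite mul1r.
- move=> [erg cvg]; split => //; exists 1; split => // A mA.
  rewrite mul1e (cvg_limn_esup_box (m := mus) Tmeas A mA)//.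
  by apply: (cvg (fun i => \1_(A i))) => i; exact: bmeas_indic.
- move=> [erg [C [C0 HC]]] f bf.
  (* [ergprod] quantifies over all product measures, so one must be exhibited before it can be
     used. *)
  have [nu nuP] := product_measure_exists k mus.
  exact: (limsup_joint_ergodic Tmeas Tinv nuP (erg nu nuP) C C0 HC).
Qed.
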